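(* Let $\phi(r)=\sum_{i=0}^{\infty}A_i\,r^i$ be any transcendental growth function with $A_i>0$ for all $i\geqslant 0$ and $\lim_{i\to\infty}A_{i+1}/A_i=0$. Then there exists a universal entire holomorphic function $F\in\mathcal{H}(\mathbb{C})$ with slow growth $$|F(z)|\leqslant\phi(|z|)\qquad(\forall\, z\in\mathbb{C}),$$ such that the set $I\subset\mathbb{S}^1$ of hypercyclic directions of $F$ is uncountable.
   Context: $\mathcal{H}(\mathbb{C})$ is the space of entire holomorphic functions on $\mathbb{C}$ with the topology of uniform convergence on compact sets. For $a\in\mathbb{C}\setminus\{0\}$, the translation operator $\mathsf{T}_a:\mathcal{H}(\mathbb{C})\to\mathcal{H}(\mathbb{C})$ is $f(\bullet)\mapsto f(\bullet+a)$. An element $f$ is hypercyclic for $\mathsf{T}_a$ if the orbit $\{f,\mathsf{T}_a(f),\mathsf{T}_a^{2}(f),\dots\}$ is dense in $\mathcal{H}(\mathbb{C})$. The hypercyclic directions of $F$ are the set $I$ of all $a$ in the unit circle $\mathbb{S}^1\subset\mathbb{C}$ such that $F$ is hypercyclic for $\mathsf{T}_a$. A function $F$ is universal if every $H\in\mathcal{H}(\mathbb{C})$ is a limit (uniform on compact sets) of translates $F(\bullet+a_i)$ for some sequence $\{a_i\}$ in $\mathbb{C}$. *)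

(* Defs.v *)
From Stdlib Require Import Reals Lra List.
From Coquelicot Require Export Coquelicot.

Open Scope R_scope.

Definition entire (f : C -> C) : Prop :=
  forall z : C, @ex_derive C_AbsRing C_NormedModule f z.

Definition compact_set (K : C -> Prop) : Prop :=
  forall (J : Type) (U : J -> C -> Prop),
    (forall j, @open C_UniformSpace (U j)) ->
    (forall z, K z -> exists j, U j z) ->
    exists l : list J, forall z, K z -> exists j, In j l /\ U j z.

(* Neighbourhood filter of H for uniform convergence on compact sets, on the
   space of all functions C -> C; H(C) carries the subspace topology. *)
Definition compact_conv_locally (H : C -> C) (P : (C -> C) -> Prop) : Prop :=
  exists (K : C -> Prop) (eps : R),
    compact_set K /\ 0 < eps /\
    forall G : C -> C, (forall z, K z -> Cmod (G z - H z) < eps) -> P G.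

(* S is meant to be a set of entire functions. *)
Definition dense_in_entire (S : (C -> C) -> Prop) : Prop :=
  forall H, entire H ->
  forall P, compact_conv_locally H P -> exists G, S G /\ P G.

Definition translate (a : C) (f : C -> C) : C -> C := fun z => f (z + a)%C.

Definition orbit (a : C) (F : C -> C) : (C -> C) -> Prop :=
  fun G => exists n : nat, G = Nat.iter n (translate a) F.

Definition hypercyclic (a : C) (F : C -> C) : Prop :=
  dense_in_entire (orbit a F).

Definition hypercyclic_directions (F : C -> C) : C -> Prop :=
  fun a => Cmod a = 1 /\ hypercyclic a F.

Definition universal (F : C -> C) : Prop :=
  forall H, entire H ->
  exists a : nat -> C,
    filterlim (fun i => translate (a i) F) eventually (compact_conv_locally H).

(* Enumerations may repeat and leave S, so finite and empty sets are countable. *)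
Definition countable (S : C -> Prop) : Prop :=
  exists e : nat -> C, forall a, S a -> exists n, e n = a.

Lemma compact_set_union (K L : C -> Prop) :
  compact_set K -> compact_set L -> compact_set (fun z => K z \/ L z).
Proof.
intros HK HL J U HU Hcov.
destruct (HK J U HU) as [k Hk]; [now auto|].
destruct (HL J U HU) as [l Hl]; [now auto|].
exists (k ++ l)%list; intros z [Hz|Hz].
- destruct (Hk z Hz) as [j [Hj Uj]]; exists j; split; auto using in_or_app.
- destruct (Hl z Hz) as [j [Hj Uj]]; exists j; split; auto using in_or_app.
Qed.

Lemma compact_set_empty : compact_set (fun _ => False).
Proof. intros J U _ _; exists nil; intros z []. Qed.

Global Instance compact_conv_locally_filter (H : C -> C) :
  ProperFilter (compact_conv_locally H).
Proof.
split.
- intros P (K & eps & _ & Heps & HP); exists H; apply HP; intros z _.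
  replace (H z - H z)%C with (RtoC 0) by ring; now rewrite Cmod_0.
- split.
  + exists (fun _ => False), 1; split; [apply compact_set_empty|split; [lra|easy]].
  + intros P Q (K & e & HK & He & HP) (L & d & HL & Hd & HQ).
    exists (fun z => K z \/ L z), (Rmin e d).
    split; [now apply compact_set_union|].
    split; [now apply Rmin_pos|].
    intros G HG; split.
    * apply HP; intros z Hz; eapply Rlt_le_trans; [apply HG; now left|apply Rmin_l].
    * apply HQ; intros z Hz; eapply Rlt_le_trans; [apply HG; now right|apply Rmin_r].
  + intros P Q HPQ (K & e & HK & He & HP); exists K, e; auto.
Qed.

Lemma entire_translate (a : C) (f : C -> C) : entire f -> entire (translate a f).
Proof.
intros Hf z; destruct (Hf (z + a)%C) as [l Hl]; exists l.
destruct Hl as [Hlin Hl]; split; [exact Hlin|].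
intros x Hx eps.
assert (x = z) as -> by (symmetry;
  now apply (is_filter_lim_locally_unique (V := AbsRing_NormedModule C_AbsRing))).
destruct (Hl (z + a)%C (fun P HP => HP) eps) as [d Hd].
exists d; intros y Hy.
assert (E' : minus (y + a)%C (z + a)%C = minus (y : C_AbsRing) z).
{ change ((y + a) - (z + a) = y - z)%C; ring. }
assert (Hya : ball (z + a : C_AbsRing)%C d (y + a)%C).
{ change (abs (minus (y + a)%C (z + a)%C : C_AbsRing) < d).
  rewrite E'; exact Hy. }
specialize (Hd (y + a)%C Hya).
change (Cmod (f (y + a) - f (z + a) - ((y + a) - (z + a)) * l)%C
  <= eps * Cmod ((y + a) - (z + a))%C) in Hd.
change (Cmod (f (y + a) - f (z + a) - (y - z) * l)%C <= eps * Cmod (y - z)%C).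
now replace (y - z)%C with ((y + a) - (z + a))%C by ring.
Qed.

(* Main.v *)
Require Import Defs.
From Stdlib Require Import Reals Lra Lia List Classical ClassicalEpsilon Cantor.
From Coquelicot Require Import Coquelicot.
Open Scope R_scope.

(** Any partial sum can be corrected near a point far away by a polynomial
    whose coefficients are as small as we please, so prescribing the behaviour
    of [F] far out costs nothing in growth.  Given polynomials [G] and [P], a
    radius [r] and a point [b] with [|b| = n], put [y = (z / b)^D] and
    [g(z) = (P(z - b) - G(z)) * (1 - (1 - y)^D)].  At [z = w + b] with
    [|w| <= r], the difference between [G + g] and [P(w)] is
    [(G - P) * (1 - y)^D], where the first factor grows at most like [n^m], with
    [m] controlled by the degrees, and the second is [O(n^(-D))].  On the other
    hand [1 - (1 - y)^D] is divisible by [y], so the coefficients of [g] are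
    [O(n^(m - D))].  With [D = m + 1] both errors are [O(1/n)], while the degree
    of [g] does not depend on [n] ([polynomial_correction]).

    Enumerate all pairs of a polynomial [P] with rational coefficients and a
    direction [cis s] with [s] rational, each pair infinitely often, and let [F]
    be the sum of the successive corrections.  As their degree is known before
    their size is chosen, each correction can be made smaller than [2^-k phi]
    everywhere and so small, together with its derivative and its second order
    Taylor remainder, on a disc containing everything treated before, that [F]
    is entire and keeps all the approximations ([approximation_scheme]).

    For fixed [P] and [M], the angles [t] such that some [F(w + n cis t)]
    approximates [P(w)] on the disc of radius [M] contain an interval in every
    interval, since they contain a neighbourhood of a rational angle.  By a
    Baire argument the angles good for all [P] and [M] at once cannot be
    enumerated: given an enumeration, nested intervals produce such an angle
    outside of it ([baire_interval]).  Each of these directions is hypercyclic,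
    and any one of them gives universality.

    The passage from polynomials to all entire functions is the density of
    polynomials, [entire_polynomial_approx].  Entire only means
    differentiable at every point, so the proof starts from Goursat's bisection
    argument.  It is run in the parameter plane of the map
    [(x,t) |-> z + e^x (r cis t - z)], which contracts the circle of radius [r]
    around the origin to the point [z].  This gives Cauchy's formula
    ([cauchy_formula]), and a finite geometric expansion of its kernel gives
    polynomials with an explicit error ([taylor_poly_error]). *)

(** * Preliminaries *)

Lemma Cmod_minus_sym (x y : C) : Cmod (x - y)%C = Cmod (y - x)%C.
Proof. rewrite <- Cmod_opp; f_equal; ring. Qed.

Lemma Cmod_minus_triangle (x y w : C) :
  Cmod (x - w)%C <= Cmod (x - y)%C + Cmod (y - w)%C.
Proof.
replace (x - w)%C with ((x - y) + (y - w))%C by ring; apply Cmod_triangle.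
Qed.

Lemma Cmod_le_add (x y : C) : Cmod x <= Cmod y + Cmod (x - y)%C.
Proof. replace x with (y + (x - y))%C at 1 by ring; apply Cmod_triangle. Qed.

Lemma Cmod_Re_Im (z : C) : Cmod z <= Rabs (Re z) + Rabs (Im z).
Proof.
replace z with (RtoC (Re z) + RtoC (Im z) * Ci)%C at 1
  by (destruct z as [x y]; unfold Re, Im; cbn;
      apply injective_projections; cbn; ring).
eapply Rle_trans; [apply Cmod_triangle|].
rewrite Cmod_mult, !Cmod_R, Cmod_Ci; lra.
Qed.

Lemma Rabs_Im_le (z : C) : Rabs (Im z) <= Cmod z.
Proof. eapply Rle_trans; [apply Rmax_r|apply Rmax_Cmod]. Qed.

Lemma functional_choice {X Y : Type} (Rel : X -> Y -> Prop) :
  (forall x, exists y, Rel x y) -> exists f : X -> Y, forall x, Rel x (f x).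
Proof.
intros H.
exists (fun x => proj1_sig (constructive_indefinite_description _ (H x))).
intros x; exact (proj2_sig (constructive_indefinite_description _ (H x))).
Qed.

Lemma nested_intervals (u v : nat -> R) :
  (forall n, u n <= u (S n)) -> (forall n, v (S n) <= v n) ->
  (forall n, u n <= v n) -> exists t, forall n, u n <= t <= v n.
Proof.
intros Hu Hv Huv.
assert (Hu' : forall n k, u n <= u (n + k)%nat).
{ intros n k; induction k as [|k IH].
  - replace (n + 0)%nat with n by lia; lra.
  - replace (n + S k)%nat with (S (n + k)) by lia; specialize (Hu (n + k)%nat); lra. }
assert (Hv' : forall n k, v (n + k)%nat <= v n).
{ intros n k; induction k as [|k IH].
  - replace (n + 0)%nat with n by lia; lra.
  - replace (n + S k)%nat with (S (n + k)) by lia; specialize (Hv (n + k)%nat); lra. }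
assert (H : forall n m, u n <= v m).
{ intros n m; specialize (Hu' n m); specialize (Hv' m n).
  replace (m + n)%nat with (n + m)%nat in Hv' by lia.
  specialize (Huv (n + m)%nat); lra. }
destruct (completeness (fun x => exists n, x = u n)) as [t [Ht1 Ht2]].
- exists (v O); intros x [n ->]; apply H.
- exists (u O); now exists O.
- exists t; intros n; split.
  + apply Ht1; now exists n.
  + apply Ht2; intros x [m ->]; apply H.
Qed.

(** * Goursat's argument on parameter rectangles *)

(** If [Phi] were not zero on some rectangle, one of its quarters would carry
    at least a quarter of the modulus, and so on: [Phi] would stay proportional
    to the squared perimeter along rectangles shrinking to a point, where it is
    supposed to be negligible.  The exponent [2] is exactly what
    quartering preserves. *)
Lemma bisection_zero (Phi : R -> R -> R -> R -> C) :
  (forall a m b c d, Phi a b c d = (Phi a m c d + Phi m b c d)%C) ->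
  (forall a b c m d, Phi a b c d = (Phi a b c m + Phi a b m d)%C) ->
  (forall p q eps, 0 < eps -> exists del, 0 < del /\
     forall a b c d, a <= p <= b -> c <= q <= d ->
       b - a <= del -> d - c <= del ->
       Cmod (Phi a b c d) <= eps * ((b - a) + (d - c)) ^ 2) ->
  forall a b c d, a <= b -> c <= d -> Phi a b c d = 0.
Proof.
intros Hx Ht Hloc a0 b0 c0 d0 Hab Hcd.
apply NNPP; intros Hne.
assert (Hpos : 0 < Cmod (Phi a0 b0 c0 d0)) by now apply Cmod_gt_0.
set (big := fun e (Q : (R * R) * (R * R)) =>
  e * ((snd (fst Q) - fst (fst Q)) + (snd (snd Q) - fst (snd Q))) ^ 2
    <= Cmod (Phi (fst (fst Q)) (snd (fst Q)) (fst (snd Q)) (snd (snd Q)))).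
assert (Hper : 0 < (b0 - a0) + (d0 - c0)).
{ destruct (Rle_lt_or_eq_dec 0 ((b0 - a0) + (d0 - c0))) as [H|H]; [lra|easy|].
  assert (b0 = a0) as -> by lra.
  assert (E := Hx a0 a0 a0 c0 d0).
  exfalso; apply Hne.
  replace (Phi a0 a0 c0 d0)
    with ((Phi a0 a0 c0 d0 + Phi a0 a0 c0 d0) - Phi a0 a0 c0 d0)%C by ring.
  rewrite <- E; ring. }
set (e := Cmod (Phi a0 b0 c0 d0) / ((b0 - a0) + (d0 - c0)) ^ 2).
assert (He : 0 < e) by (apply Rdiv_lt_0_compat; [easy|now apply pow_lt]).
(* Among the four quarters, one has at least a quarter of the mass. *)
assert (Hstep : forall Q : (R * R) * (R * R), exists Q' : (R * R) * (R * R),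
  big e Q -> big e Q' /\
  (fst (fst Q) <= snd (fst Q) ->
   fst (fst Q) <= fst (fst Q') /\ snd (fst Q') <= snd (fst Q) /\
   snd (fst Q') - fst (fst Q') = (snd (fst Q) - fst (fst Q)) / 2) /\
  (fst (snd Q) <= snd (snd Q) ->
   fst (snd Q) <= fst (snd Q') /\ snd (snd Q') <= snd (snd Q) /\
   snd (snd Q') - fst (snd Q') = (snd (snd Q) - fst (snd Q)) / 2)).
{ intros [[a b] [c d]]; unfold big; cbn [fst snd].
  set (m := (a + b) / 2); set (n := (c + d) / 2).
  destruct (Rle_or_lt (e * ((b - a) + (d - c)) ^ 2) (Cmod (Phi a b c d)))
    as [H|H]; [|exists ((a, b), (c, d)); intros H'; lra].
  assert (Hsum : Cmod (Phi a b c d) <=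
    Cmod (Phi a m c n) + Cmod (Phi a m n d)
    + (Cmod (Phi m b c n) + Cmod (Phi m b n d))).
  { rewrite (Hx a m b), (Ht a m c n d), (Ht m b c n d).
    eapply Rle_trans; [apply Cmod_triangle|].
    apply Rplus_le_compat; apply Cmod_triangle. }
  assert (Hm : m - a = (b - a) / 2 /\ b - m = (b - a) / 2) by (unfold m; lra).
  assert (Hn : n - c = (d - c) / 2 /\ d - n = (d - c) / 2) by (unfold n; lra).
  set (S := ((b - a) + (d - c)) ^ 2) in *.
  assert (HS : ((b - a) / 2 + (d - c) / 2) ^ 2 = S / 4) by (unfold S; field).
  destruct (Rle_or_lt (e * (S / 4)) (Cmod (Phi a m c n))).
  { exists ((a, m), (c, n)); cbn [fst snd]; intros _.
    destruct Hm as [Hm1 Hm2], Hn as [Hn1 Hn2]; rewrite Hm1, Hn1, HS.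
    repeat split; try lra. }
  destruct (Rle_or_lt (e * (S / 4)) (Cmod (Phi a m n d))).
  { exists ((a, m), (n, d)); cbn [fst snd]; intros _.
    destruct Hm as [Hm1 Hm2], Hn as [Hn1 Hn2]; rewrite Hm1, Hn2, HS.
    repeat split; try lra. }
  destruct (Rle_or_lt (e * (S / 4)) (Cmod (Phi m b c n))).
  { exists ((m, b), (c, n)); cbn [fst snd]; intros _.
    destruct Hm as [Hm1 Hm2], Hn as [Hn1 Hn2]; rewrite Hm2, Hn1, HS.
    repeat split; try lra. }
  exists ((m, b), (n, d)); cbn [fst snd]; intros _.
  destruct Hm as [Hm1 Hm2], Hn as [Hn1 Hn2]; rewrite Hm2, Hn2, HS.
  repeat split; try lra. }
destruct (functional_choice _ Hstep) as [nx Hnx]; clear Hstep.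
set (Q := fix Q n := match n with O => ((a0, b0), (c0, d0)) | S n => nx (Q n) end).
assert (HQ : forall n, big e (Q n) /\
   snd (fst (Q n)) - fst (fst (Q n)) = (b0 - a0) / 2 ^ n /\
   snd (snd (Q n)) - fst (snd (Q n)) = (d0 - c0) / 2 ^ n).
{ induction n as [|n [H1 [H2 H3]]].
  - cbn; split; [|split; field].
    unfold big; cbn [fst snd]; unfold e; apply Req_le; field; lra.
  - assert (P2 : 0 < / 2 ^ n) by (apply Rinv_0_lt_compat, pow_lt; lra).
    destruct (Hnx (Q n) H1) as (H4 & H5 & H6).
    change (Q (S n)) with (nx (Q n)).
    split; [easy|].
    split.
    + destruct H5 as (_ & _ & ->); [unfold Rdiv in H2; nra|].
      rewrite H2; cbn; field; apply pow_nonzero; lra.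
    + destruct H6 as (_ & _ & ->); [unfold Rdiv in H3; nra|].
      rewrite H3; cbn; field; apply pow_nonzero; lra. }
assert (Hlen : forall n, fst (fst (Q n)) <= snd (fst (Q n))
                      /\ fst (snd (Q n)) <= snd (snd (Q n))).
{ intros n; destruct (HQ n) as (_ & H1 & H2).
  assert (P2 : 0 < / 2 ^ n) by (apply Rinv_0_lt_compat, pow_lt; lra).
  unfold Rdiv in H1, H2; split; nra. }
destruct (nested_intervals (fun n => fst (fst (Q n))) (fun n => snd (fst (Q n))))
  as [p Hp].
{ intros n; apply (Hnx (Q n)); [apply HQ|apply Hlen]. }
{ intros n; apply (Hnx (Q n)); [apply HQ|apply Hlen]. }
{ intros n; apply Hlen. }
destruct (nested_intervals (fun n => fst (snd (Q n))) (fun n => snd (snd (Q n))))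
  as [q Hq].
{ intros n; apply (Hnx (Q n)); [apply HQ|apply Hlen]. }
{ intros n; apply (Hnx (Q n)); [apply HQ|apply Hlen]. }
{ intros n; apply Hlen. }
destruct (Hloc p q (e / 2) ltac:(lra)) as (del & Hdel & Hsmall).
destruct (pow_lt_1_zero (/ 2) ltac:(rewrite Rabs_right; lra)
  (del / ((b0 - a0) + (d0 - c0))) ltac:(now apply Rdiv_lt_0_compat)) as [n Hn].
specialize (Hn n (Nat.le_refl n)).
rewrite Rabs_right in Hn by (apply Rle_ge, pow_le; lra).
rewrite pow_inv in Hn.
assert (P2 : 0 < / 2 ^ n) by (apply Rinv_0_lt_compat, pow_lt; lra).
apply (Rmult_lt_compat_r _ _ _ Hper) in Hn.
unfold Rdiv in Hn; rewrite Rmult_assoc, Rinv_l, Rmult_1_r in Hn by lra.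
destruct (HQ n) as (H1 & H2 & H3).
specialize (Hsmall _ _ _ _ (Hp n) (Hq n)).
unfold Rdiv in *.
assert (B1 : snd (fst (Q n)) - fst (fst (Q n)) <= del) by nra.
assert (B2 : snd (snd (Q n)) - fst (snd (Q n)) <= del) by nra.
specialize (Hsmall B1 B2).
unfold big in H1; rewrite H2, H3 in *.
set (s := ((b0 - a0) * / 2 ^ n + (d0 - c0) * / 2 ^ n)) in *.
assert (Hs : 0 < s) by (unfold s; nra).
assert (0 < s ^ 2) by now apply pow_lt.
nra.
Qed.

(** * Integrals of complex functions of a real variable *)

(** Continuity on all of [R] with the modulus as the distance on [C], so that no
    translation between the product and the modulus balls of [C] is needed in
    estimates. *)
Definition ctn (u : R -> C) : Prop :=
  forall t eps, 0 < eps -> exists del, 0 < del /\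
    forall s, Rabs (s - t) < del -> Cmod (u s - u t)%C < eps.

Definition cint (u : R -> C) (a b : R) : C := @RInt C_R_CompleteNormedModule u a b.

Lemma ctn_Lipschitz (u : R -> C) (L : R) :
  (forall s t, Cmod (u s - u t)%C <= L * Rabs (s - t)) -> ctn u.
Proof.
intros H t eps He.
assert (HL : 0 < Rabs L + 1) by (assert (H0 := Rabs_pos L); lra).
exists (eps / (Rabs L + 1)); split; [now apply Rdiv_lt_0_compat|].
intros s Hs.
apply (Rmult_lt_compat_l _ _ _ HL) in Hs.
replace ((Rabs L + 1) * (eps / (Rabs L + 1))) with eps in Hs by (field; lra).
assert (H1 := H s t); assert (H2 := Rle_abs L); assert (H3 := Rabs_pos (s - t)).
nra.
Qed.

Lemma ctn_const (c : C) : ctn (fun _ => c).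
Proof.
apply ctn_Lipschitz with 0; intros s t.
replace (c - c)%C with (RtoC 0) by ring; rewrite Cmod_0; lra.
Qed.

Lemma ctn_plus (u v : R -> C) : ctn u -> ctn v -> ctn (fun t => u t + v t)%C.
Proof.
intros Hu Hv t eps He.
destruct (Hu t (eps / 2)) as (d1 & Hd1 & H1); [lra|].
destruct (Hv t (eps / 2)) as (d2 & Hd2 & H2); [lra|].
exists (Rmin d1 d2); split; [now apply Rmin_pos|].
intros s Hs.
specialize (H1 s (Rlt_le_trans _ _ _ Hs (Rmin_l _ _))).
specialize (H2 s (Rlt_le_trans _ _ _ Hs (Rmin_r _ _))).
replace (u s + v s - (u t + v t))%C with ((u s - u t) + (v s - v t))%C by ring.
eapply Rle_lt_trans; [apply Cmod_triangle|lra].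
Qed.

Lemma ctn_mult (u v : R -> C) : ctn u -> ctn v -> ctn (fun t => u t * v t)%C.
Proof.
intros Hu Hv t eps He.
assert (U := Cmod_ge_0 (u t)); assert (V := Cmod_ge_0 (v t)).
set (k := Cmod (u t) + Cmod (v t) + 1).
assert (Hk : 0 < k) by (unfold k; lra).
assert (Hek : 0 < eps / (2 * k)) by (apply Rdiv_lt_0_compat; lra).
destruct (Hu t (Rmin 1 (eps / (2 * k)))) as (d1 & Hd1 & H1); [apply Rmin_pos; lra|].
destruct (Hv t (eps / (2 * k)) Hek) as (d2 & Hd2 & H2).
exists (Rmin d1 d2); split; [now apply Rmin_pos|].
intros s Hs.
specialize (H1 s (Rlt_le_trans _ _ _ Hs (Rmin_l _ _))).
specialize (H2 s (Rlt_le_trans _ _ _ Hs (Rmin_r _ _))).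
assert (H3 := Rlt_le_trans _ _ _ H1 (Rmin_l _ _)).
assert (H4 := Rlt_le_trans _ _ _ H1 (Rmin_r _ _)).
assert (H5 : Cmod (u s) <= k).
{ assert (H6 := Cmod_le_add (u s) (u t)); unfold k; lra. }
replace (u s * v s - u t * v t)%C
  with (u s * (v s - v t) + (u s - u t) * v t)%C by ring.
eapply Rle_lt_trans; [apply Cmod_triangle|].
rewrite !Cmod_mult.
replace eps with (k * (eps / (2 * k)) + (eps / (2 * k)) * k) by (field; lra).
assert (Cmod (v t) < k) by (unfold k; lra).
assert (W := Cmod_ge_0 (v s - v t)%C); assert (W' := Cmod_ge_0 (u s - u t)%C).
apply Rle_lt_trans with (k * Cmod (v s - v t)%C + Cmod (u s - u t)%C * k).
- apply Rplus_le_compat; [now apply Rmult_le_compat_r|].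
  apply Rmult_le_compat_l; lra.
- apply Rplus_lt_compat; [now apply Rmult_lt_compat_l|now apply Rmult_lt_compat_r].
Qed.

Lemma ctn_cmult (c : C) (u : R -> C) : ctn u -> ctn (fun t => c * u t)%C.
Proof. intros Hu; apply (ctn_mult (fun _ => c)); [apply ctn_const|easy]. Qed.

Lemma ctn_minus (u v : R -> C) : ctn u -> ctn v -> ctn (fun t => u t - v t)%C.
Proof.
intros Hu Hv t eps He.
destruct (ctn_plus u (fun t => (-(1) * v t)%C) Hu (ctn_cmult _ v Hv) t eps He)
  as (d & Hd & H).
exists d; split; [easy|]; intros s Hs.
replace (u s - v s - (u t - v t))%C
  with (u s + - (1) * v s - (u t + - (1) * v t))%C by ring.
now apply H.
Qed.

Lemma ctn_continuous (u : R -> C) (t : R) :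
  ctn u -> @continuous R_UniformSpace C_R_CompleteNormedModule u t.
Proof.
intros Hu.
apply (proj2 (filterlim_locally _ _)); intros eps.
destruct (Hu t eps (cond_pos eps)) as (d & Hd & H).
exists (mkposreal d Hd); intros s Hs.
apply C_NormedModule_mixin_compat1, H, Hs.
Qed.

Lemma ex_cint (u : R -> C) (a b : R) :
  ctn u -> @ex_RInt C_R_CompleteNormedModule u a b.
Proof.
intros Hu; apply (ex_RInt_continuous (V := C_R_CompleteNormedModule)).
intros t _; now apply ctn_continuous.
Qed.

Lemma is_cint (u : R -> C) (a b : R) :
  ctn u -> @is_RInt C_R_CompleteNormedModule u a b (cint u a b).
Proof.
intros Hu; apply (RInt_correct (V := C_R_CompleteNormedModule)); now apply ex_cint.
Qed.

Lemma cint_Chasles (u : R -> C) (a b c : R) :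
  ctn u -> cint u a c = (cint u a b + cint u b c)%C.
Proof.
intros Hu; symmetry.
apply (RInt_Chasles (V := C_R_CompleteNormedModule)); now apply ex_cint.
Qed.

Lemma cint_plus (u v : R -> C) (a b : R) : ctn u -> ctn v ->
  cint (fun t => u t + v t)%C a b = (cint u a b + cint v a b)%C.
Proof.
intros Hu Hv; apply (RInt_plus (V := C_R_CompleteNormedModule)); now apply ex_cint.
Qed.

Lemma cint_minus (u v : R -> C) (a b : R) : ctn u -> ctn v ->
  cint (fun t => u t - v t)%C a b = (cint u a b - cint v a b)%C.
Proof.
intros Hu Hv; apply (RInt_minus (V := C_R_CompleteNormedModule)); now apply ex_cint.
Qed.

Lemma cint_ext (u v : R -> C) (a b : R) :
  (forall t, u t = v t) -> cint u a b = cint v a b.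
Proof.
intros H; apply (RInt_ext (V := C_R_CompleteNormedModule)); intros t _; apply H.
Qed.

Lemma cint_cmult (c : C) (u : R -> C) (a b : R) : ctn u ->
  cint (fun t => c * u t)%C a b = (c * cint u a b)%C.
Proof.
intros Hu.
assert (H := is_cint u a b Hu).
apply (is_RInt_unique (V := C_R_CompleteNormedModule)).
assert (H1 := is_RInt_fct_extend_fst (U := R_NormedModule) (V := R_NormedModule)
  _ _ _ _ H).
assert (H2 := is_RInt_fct_extend_snd (U := R_NormedModule) (V := R_NormedModule)
  _ _ _ _ H).
apply (is_RInt_fct_extend_pair (U := R_NormedModule) (V := R_NormedModule)
  (fun t => c * u t)%C).
- exact (is_RInt_minus _ _ _ _ _ _ (is_RInt_scal _ _ _ (fst c) _ H1)
    (is_RInt_scal _ _ _ (snd c) _ H2)).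
- exact (is_RInt_plus _ _ _ _ _ _ (is_RInt_scal _ _ _ (fst c) _ H2)
    (is_RInt_scal _ _ _ (snd c) _ H1)).
Qed.

Lemma cint_bound (u : R -> C) (a b M : R) : ctn u -> a <= b ->
  (forall t, a <= t <= b -> Cmod (u t) <= M) ->
  Cmod (cint u a b) <= (b - a) * M.
Proof.
intros Hu Hab HM.
rewrite Cmod_norm.
apply (norm_RInt_le_const (V := C_R_CompleteNormedModule) u); [easy| |now apply is_cint].
intros t Ht; specialize (HM t Ht); now rewrite Cmod_norm in HM.
Qed.

Lemma cint_derive (U u : R -> C) (a b : R) : ctn u ->
  (forall t, is_derive (fun t => Re (U t)) t (Re (u t))) ->
  (forall t, is_derive (fun t => Im (U t)) t (Im (u t))) ->
  cint u a b = (U b - U a)%C.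
Proof.
intros Hu HR HI.
assert (Hc : forall t, continuous (fun t => Re (u t)) t
                    /\ continuous (fun t => Im (u t)) t).
{ intros t; split; apply (proj2 (filterlim_locally _ _)); intros eps;
    destruct (Hu t eps (cond_pos eps)) as (d & Hd & H);
    exists (mkposreal d Hd); intros s Hs; specialize (H s Hs).
  - eapply Rle_lt_trans; [|exact H].
    replace (minus _ _) with (Re (u s - u t)%C) by reflexivity; apply re_le_Cmod.
  - eapply Rle_lt_trans; [|exact H].
    replace (minus _ _) with (Im (u s - u t)%C) by reflexivity; apply Rabs_Im_le. }
apply (is_RInt_unique (V := C_R_CompleteNormedModule)).
apply (is_RInt_fct_extend_pair (U := R_NormedModule) (V := R_NormedModule) u).
- apply (is_RInt_derive (V := R_CompleteNormedModule) (fun t => Re (U t))); intros t _;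
    [apply HR|apply Hc].
- apply (is_RInt_derive (V := R_CompleteNormedModule) (fun t => Im (U t))); intros t _;
    [apply HI|apply Hc].
Qed.

(** * Cauchy's formula on a circle *)

Lemma entire_linear_approx (f : C -> C) (z : C) : entire f ->
  exists l : C, forall eps, 0 < eps -> exists del, 0 < del /\
    forall w, Cmod (w - z)%C < del ->
      Cmod (f w - f z - l * (w - z))%C <= eps * Cmod (w - z)%C.
Proof.
intros Hf; destruct (Hf z) as [l [_ Hl]]; exists l; intros eps He.
destruct (Hl z (fun P HP => HP) (mkposreal eps He)) as [d Hd].
exists d; split; [apply cond_pos|]; intros w Hw.
specialize (Hd w Hw).
change (Cmod (f w - f z - (w - z) * l)%C <= eps * Cmod (w - z)%C) in Hd.
now rewrite (Cmult_comm l).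
Qed.

Lemma entire_continuous (f : C -> C) (z : C) (eps : R) : entire f -> 0 < eps ->
  exists del, 0 < del /\ forall w, Cmod (w - z)%C < del -> Cmod (f w - f z)%C < eps.
Proof.
intros Hf He.
destruct (entire_linear_approx f z Hf) as [l Hl].
destruct (Hl 1 Rlt_0_1) as (d & Hd & H).
assert (L := Cmod_ge_0 l).
exists (Rmin d (eps / (Cmod l + 2))).
split; [apply Rmin_pos; [easy|apply Rdiv_lt_0_compat; lra]|].
intros w Hw.
specialize (H w (Rlt_le_trans _ _ _ Hw (Rmin_l _ _))).
assert (H2 := Rlt_le_trans _ _ _ Hw (Rmin_r _ _)).
apply (Rmult_lt_compat_l (Cmod l + 2)) in H2; [|lra].
replace ((Cmod l + 2) * (eps / (Cmod l + 2))) with eps in H2 by (field; lra).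
assert (H3 := Cmod_le_add (f w - f z)%C (l * (w - z))%C).
rewrite Cmod_mult in H3.
assert (W := Cmod_ge_0 (w - z)%C); nra.
Qed.

Lemma ctn_comp_entire (f : C -> C) (u : R -> C) : entire f -> ctn u ->
  ctn (fun t => f (u t)).
Proof.
intros Hf Hu t eps He.
destruct (entire_continuous f (u t) eps Hf He) as (d & Hd & H).
destruct (Hu t d Hd) as (d' & Hd' & H'); exists d'; split; [easy|].
intros s Hs; now apply H, H'.
Qed.

Definition cis (t : R) : C := (cos t, sin t).

Lemma Cmod_cis (t : R) : Cmod (cis t) = 1.
Proof.
unfold Cmod, cis; cbn [fst snd].
replace (cos t ^ 2 + sin t ^ 2) with 1; [apply sqrt_1|].
rewrite <- (sin2_cos2 t); unfold Rsqr; ring.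
Qed.

Lemma Rabs_diff_le_derive (f df : R -> R) (L : R) (s t : R) :
  (forall x, is_derive f x (df x)) ->
  (forall x, Rmin s t <= x <= Rmax s t -> Rabs (df x) <= L) ->
  Rabs (f s - f t) <= L * Rabs (s - t).
Proof.
intros Hd HL.
destruct (MVT_gen f t s df) as (x & Hx & E).
- intros; apply Hd.
- intros x _; apply continuity_pt_filterlim.
  apply (ex_derive_continuous (V := R_NormedModule)); now exists (df x).
- rewrite E, Rabs_mult; apply Rmult_le_compat_r; [apply Rabs_pos|].
  apply HL; now rewrite (Rmin_comm s), (Rmax_comm s).
Qed.

Lemma cis_Lipschitz (s t : R) : Cmod (cis s - cis t)%C <= 2 * Rabs (s - t).
Proof.
eapply Rle_trans; [apply Cmod_Re_Im|].
change (Re (cis s - cis t)%C) with (cos s - cos t).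
change (Im (cis s - cis t)%C) with (sin s - sin t).
assert (Rabs (cos s - cos t) <= 1 * Rabs (s - t)).
{ apply (Rabs_diff_le_derive cos (fun x => - sin x)).
  - intros x; auto_derive; [easy|ring].
  - intros x _; rewrite Rabs_Ropp; apply Rabs_le; apply SIN_bound. }
assert (Rabs (sin s - sin t) <= 1 * Rabs (s - t)).
{ apply (Rabs_diff_le_derive sin cos).
  - intros x; auto_derive; [easy|ring].
  - intros x _; apply Rabs_le; apply COS_bound. }
lra.
Qed.

Lemma exp_Lipschitz_near (p x : R) : Rabs (x - p) <= 1 ->
  Rabs (exp x - exp p) <= exp (p + 1) * Rabs (x - p).
Proof.
intros H; apply (Rabs_diff_le_derive exp exp).
- intros y; auto_derive; [easy|ring].
- intros y [_ Hy]; rewrite Rabs_pos_eq by apply Rlt_le, exp_pos.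
  apply Rabs_le_between in H.
  assert (Hy' : y <= p + 1).
  { eapply Rle_trans; [exact Hy|]; apply Rmax_lub; lra. }
  destruct Hy' as [Hy'| ->]; [|lra]; apply Rlt_le; now apply exp_increasing.
Qed.

Lemma ctn_exp : ctn (fun x => RtoC (exp x)).
Proof.
intros t eps He.
assert (H0 := exp_pos (t + 1)).
exists (Rmin 1 (eps / exp (t + 1))).
split; [apply Rmin_pos; [lra|now apply Rdiv_lt_0_compat]|].
intros s Hs.
assert (H1 := Rlt_le_trans _ _ _ Hs (Rmin_l _ _)).
assert (H2 := Rlt_le_trans _ _ _ Hs (Rmin_r _ _)).
rewrite <- RtoC_minus, Cmod_R.
eapply Rle_lt_trans; [apply exp_Lipschitz_near; lra|].
apply (Rmult_lt_compat_l _ _ _ H0) in H2.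
now replace (exp (t + 1) * (eps / exp (t + 1))) with eps in H2 by (field; lra).
Qed.

(** [cone z r x t] contracts the circle of radius [r] around the origin
    ([x = 0]) to the point [z] ([x] tending to minus infinity) along the spokes
    joining [z] to the circle.  In these coordinates [dw / (w - z)] is
    [dx + kappa dt] with coefficients bounded uniformly in [x], which replaces
    the division by [w - z] near the singularity. *)
Definition spoke (z : C) (r t : R) : C := (r * cis t - z)%C.
Definition cone (z : C) (r x t : R) : C := (z + exp x * spoke z r t)%C.
(** The logarithmic derivative of [spoke z r] in [t], written so that it is
    visibly bounded. *)
Definition kappa (z : C) (r t : R) : C := (Ci + Ci * z / spoke z r t)%C.

Lemma spoke_lower (z : C) (r t : R) : 0 <= r -> r - Cmod z <= Cmod (spoke z r t).
Proof.
intros Hr.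
assert (H := Cmod_le_add (r * cis t)%C z).
rewrite Cmod_mult, Cmod_cis, Cmod_R, Rabs_pos_eq in H by easy.
unfold spoke; lra.
Qed.

Lemma spoke_upper (z : C) (r t : R) : 0 <= r -> Cmod (spoke z r t) <= r + Cmod z.
Proof.
intros Hr; unfold spoke, Cminus.
eapply Rle_trans; [apply Cmod_triangle|].
rewrite Cmod_mult, Cmod_cis, Cmod_R, Rabs_pos_eq, Cmod_opp by easy; lra.
Qed.

Lemma spoke_neq_0 (z : C) (r t : R) : Cmod z < r -> spoke z r t <> 0.
Proof.
intros Hr; apply Cmod_gt_0.
assert (Z := Cmod_ge_0 z); assert (H := spoke_lower z r t ltac:(lra)); lra.
Qed.

Lemma spoke_Lipschitz (z : C) (r s t : R) : 0 <= r ->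
  Cmod (spoke z r s - spoke z r t)%C <= 2 * r * Rabs (s - t).
Proof.
intros Hr; unfold spoke.
replace (r * cis s - z - (r * cis t - z))%C with (r * (cis s - cis t))%C by ring.
rewrite Cmod_mult, Cmod_R, Rabs_pos_eq by easy.
assert (H := cis_Lipschitz s t); nra.
Qed.

Lemma ctn_spoke (z : C) (r : R) : 0 <= r -> ctn (spoke z r).
Proof.
intros Hr; apply ctn_Lipschitz with (2 * r); intros s t; now apply spoke_Lipschitz.
Qed.

Lemma ctn_kappa (z : C) (r : R) : Cmod z < r -> ctn (kappa z r).
Proof.
intros Hr; assert (Z := Cmod_ge_0 z).
apply (ctn_plus (fun _ => Ci) (fun t => Ci * z / spoke z r t)%C); [apply ctn_const|].
apply (ctn_mult (fun _ => Ci * z)%C (fun t => / spoke z r t)%C); [apply ctn_const|].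
apply ctn_Lipschitz with (2 * r / ((r - Cmod z) * (r - Cmod z))); intros s t.
assert (Es := spoke_neq_0 z r s Hr); assert (Et := spoke_neq_0 z r t Hr).
replace (/ spoke z r s - / spoke z r t)%C
  with ((spoke z r t - spoke z r s) / (spoke z r s * spoke z r t))%C
  by (field; now split).
rewrite Cmod_div, Cmod_mult by now apply Cmult_neq_0.
assert (Hs := spoke_lower z r s ltac:(lra)); assert (Ht := spoke_lower z r t ltac:(lra)).
assert (HL := spoke_Lipschitz z r t s ltac:(lra)).
rewrite Rabs_minus_sym in HL.
unfold Rdiv; rewrite Rmult_assoc, (Rmult_comm (/ _)), <- Rmult_assoc.
apply Rmult_le_compat; [apply Cmod_ge_0|apply Rlt_le, Rinv_0_lt_compat; nra|easy|].
apply Rinv_le_contravar; nra.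
Qed.

Lemma kappa_bound (z : C) (r t : R) : Cmod z < r ->
  Cmod (kappa z r t) <= 1 + Cmod z / (r - Cmod z).
Proof.
intros Hr; assert (Z := Cmod_ge_0 z); unfold kappa.
eapply Rle_trans; [apply Cmod_triangle|].
rewrite Cmod_Ci, Cmod_div, Cmod_mult, Cmod_Ci, Rmult_1_l by now apply spoke_neq_0.
apply Rplus_le_compat_l, Rmult_le_compat_l; [easy|].
apply Rinv_le_contravar; [lra|apply spoke_lower; lra].
Qed.

(** The right-hand side is the derivative of [spoke z r]. *)
Lemma spoke_kappa (z : C) (r t : R) : Cmod z < r ->
  (spoke z r t * kappa z r t)%C = (Ci * (r * cis t))%C.
Proof.
intros Hr; assert (E := spoke_neq_0 z r t Hr); unfold kappa.
replace (spoke z r t * (Ci + Ci * z / spoke z r t))%C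
  with (Ci * (spoke z r t + z))%C by (field; easy).
unfold spoke; ring.
Qed.

(** The integral of [u * (dx + k dt)] along the boundary of the rectangle
    [[a,b] x [c,d]] of the [(x,t)]-plane. *)
Definition boundary_integral (u : R -> R -> C) (k : R -> C) (a b c d : R) : C :=
  (cint (fun x => u x c) a b + cint (fun t => u b t * k t)%C c d
   - cint (fun x => u x d) a b - cint (fun t => u a t * k t)%C c d)%C.

Definition separately_ctn (u : R -> R -> C) : Prop :=
  (forall t, ctn (fun x => u x t)) /\ (forall x, ctn (u x)).

Lemma boundary_integral_split_x u k a m b c d : separately_ctn u ->
  boundary_integral u k a b c d
  = (boundary_integral u k a m c d + boundary_integral u k m b c d)%C.
Proof.
intros [H _]; unfold boundary_integral.
rewrite (cint_Chasles _ a m b (H c)), (cint_Chasles _ a m b (H d)); ring.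
Qed.

Lemma boundary_integral_split_t u k a b c m d : separately_ctn u -> ctn k ->
  boundary_integral u k a b c d
  = (boundary_integral u k a b c m + boundary_integral u k a b m d)%C.
Proof.
intros [_ H] Hk; unfold boundary_integral.
rewrite (cint_Chasles _ c m d (ctn_mult _ _ (H a) Hk)).
rewrite (cint_Chasles _ c m d (ctn_mult _ _ (H b) Hk)); ring.
Qed.

Lemma boundary_integral_minus u v k a b c d :
  separately_ctn u -> separately_ctn v -> ctn k ->
  boundary_integral (fun x t => u x t - v x t)%C k a b c d
  = (boundary_integral u k a b c d - boundary_integral v k a b c d)%C.
Proof.
intros [U1 U2] [V1 V2] Hk; unfold boundary_integral.
rewrite (cint_ext (fun t => (u b t - v b t) * k t)%C
  (fun t => u b t * k t - v b t * k t)%C) by (intros; ring).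
rewrite (cint_ext (fun t => (u a t - v a t) * k t)%C
  (fun t => u a t * k t - v a t * k t)%C) by (intros; ring).
rewrite !cint_minus; auto using ctn_mult; ring.
Qed.

Lemma boundary_integral_bound u k a b c d K M :
  separately_ctn u -> ctn k -> a <= b -> c <= d -> 0 <= K ->
  (forall t, Cmod (k t) <= K) ->
  (forall x t, a <= x <= b -> c <= t <= d -> Cmod (u x t) <= M) ->
  Cmod (boundary_integral u k a b c d) <= (2 + 2 * K) * (((b - a) + (d - c)) * M).
Proof.
intros [U1 U2] Hk Hab Hcd HK HkK HM; unfold boundary_integral.
assert (M0 : 0 <= M).
{ eapply Rle_trans; [apply Cmod_ge_0|apply (HM a c); lra]. }
assert (B1 := cint_bound (fun x => u x c) a b M (U1 c) Hab
  ltac:(intros; apply HM; lra)).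
assert (B2 := cint_bound (fun x => u x d) a b M (U1 d) Hab
  ltac:(intros; apply HM; lra)).
assert (HB : forall x, a <= x <= b ->
  Cmod (cint (fun t => u x t * k t)%C c d) <= (d - c) * (M * K)).
{ intros x Hx; apply cint_bound; [now apply ctn_mult|easy|].
  intros t Ht; rewrite Cmod_mult.
  apply Rmult_le_compat; auto using Cmod_ge_0. }
assert (B3 := HB a ltac:(lra)); assert (B4 := HB b ltac:(lra)).
unfold Cminus.
eapply Rle_trans; [apply Cmod_triangle|].
eapply Rle_trans; [apply Rplus_le_compat_r, Cmod_triangle|].
eapply Rle_trans; [apply Rplus_le_compat_r, Rplus_le_compat_r, Cmod_triangle|].
rewrite !Cmod_opp.
assert (0 <= (d - c) * M) by (apply Rmult_le_pos; lra).
assert (0 <= (b - a) * M) by (apply Rmult_le_pos; lra).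
assert (0 <= (b - a) * M * K) by now apply Rmult_le_pos.
nra.
Qed.

(** Affine functions have a primitive, so the form is exact for them. *)
Lemma boundary_integral_affine (z A B : C) (r a b c d : R) : Cmod z < r ->
  boundary_integral (fun x t => A + B * (exp x * spoke z r t))%C (kappa z r) a b c d = 0.
Proof.
intros Hr; assert (Z := Cmod_ge_0 z).
assert (Hk := ctn_kappa z r Hr).
assert (Hsp := ctn_spoke z r ltac:(lra)).
unfold boundary_integral.
assert (Hx : forall t, cint (fun x => A + B * (exp x * spoke z r t))%C a b
   = (cint (fun _ => A) a b + B * spoke z r t * (exp b - exp a))%C).
{ intros t.
  rewrite (cint_ext _ (fun x => A + (B * spoke z r t) * exp x)%C) by (intros; ring).
  rewrite cint_plus by (try apply ctn_cmult; auto using ctn_const, ctn_exp).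
  rewrite cint_cmult by apply ctn_exp; do 2 f_equal.
  apply (cint_derive (fun x => RtoC (exp x))); [apply ctn_exp| |]; intros x; cbn; auto_derive; trivial; ring. }
assert (Ht : forall x, cint (fun t => (A + B * (exp x * spoke z r t)) * kappa z r t)%C c d
   = (cint (fun t => A * kappa z r t)%C c d
      + B * exp x * (spoke z r d - spoke z r c))%C).
{ intros x.
  rewrite (cint_ext _ (fun t => A * kappa z r t
    + (B * exp x) * (spoke z r t * kappa z r t))%C) by (intros; ring).
  rewrite cint_plus by (try apply ctn_cmult; auto using ctn_mult).
  f_equal.
  rewrite cint_cmult by now apply ctn_mult.
  f_equal.
  apply (cint_derive (spoke z r)); [now apply ctn_mult| |]; intros t; rewrite spoke_kappa by easy;
    cbn; auto_derive; trivial; ring. }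
rewrite !Hx, !Ht; ring.
Qed.

Lemma separately_ctn_affine (z A B : C) (r : R) : 0 <= r ->
  separately_ctn (fun x t => A + B * (exp x * spoke z r t))%C.
Proof.
intros Hr; assert (Hsp := ctn_spoke z r Hr); split.
- intros t; apply (ctn_plus (fun _ => A)); [apply ctn_const|].
  apply ctn_cmult, (ctn_mult (fun x => RtoC (exp x)) (fun _ => spoke z r t));
    [apply ctn_exp|apply ctn_const].
- intros x; apply (ctn_plus (fun _ => A)); [apply ctn_const|].
  now apply ctn_cmult, ctn_cmult.
Qed.

Lemma separately_ctn_cone (f : C -> C) (z : C) (r : R) : entire f -> 0 <= r ->
  separately_ctn (fun x t => f (cone z r x t)).
Proof.
intros Hf Hr; destruct (separately_ctn_affine z z 1 r Hr) as [H1 H2]; split.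
- intros t; apply ctn_comp_entire; [easy|].
  intros s e He; destruct (H1 t s e He) as (d & Hd & H); exists d; split; [easy|].
  unfold cone; intros s' Hs'; rewrite <- (Cmult_1_l (exp s' * _)).
  rewrite <- (Cmult_1_l (exp s * _)); now apply H.
- intros x; apply ctn_comp_entire; [easy|].
  intros s e He; destruct (H2 x s e He) as (d & Hd & H); exists d; split; [easy|].
  unfold cone; intros s' Hs'; rewrite <- (Cmult_1_l (exp x * spoke z r s')).
  rewrite <- (Cmult_1_l (exp x * spoke z r s)); now apply H.
Qed.

Lemma cone_Lipschitz_near (z : C) (r p q x t : R) : Cmod z < r -> Rabs (x - p) <= 1 ->
  Cmod (cone z r x t - cone z r p q)%C
  <= 2 * r * exp (p + 1) * (Rabs (x - p) + Rabs (t - q)).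
Proof.
intros Hr Hx; assert (Z := Cmod_ge_0 z); unfold cone.
replace (z + exp x * spoke z r t - (z + exp p * spoke z r q))%C
  with (RtoC (exp x - exp p) * spoke z r t + exp p * (spoke z r t - spoke z r q))%C
  by (rewrite RtoC_minus; ring).
eapply Rle_trans; [apply Cmod_triangle|].
rewrite !Cmod_mult, !Cmod_R, (Rabs_pos_eq (exp p)) by apply Rlt_le, exp_pos.
assert (H1 := exp_Lipschitz_near p x Hx).
assert (H2 := spoke_upper z r t ltac:(lra)).
assert (H3 := spoke_Lipschitz z r t q ltac:(lra)).
assert (H4 : exp p <= exp (p + 1)) by (apply Rlt_le, exp_increasing; lra).
assert (H5 := exp_pos p).
rewrite Rmult_plus_distr_l; apply Rplus_le_compat.
- apply Rle_trans with ((exp (p + 1) * Rabs (x - p)) * (2 * r)).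
  + apply Rmult_le_compat; auto using Rabs_pos, Cmod_ge_0; lra.
  + right; ring.
- apply Rle_trans with (exp (p + 1) * (2 * r * Rabs (t - q))).
  + apply Rmult_le_compat; auto using Cmod_ge_0; lra.
  + right; ring.
Qed.

(** Goursat: near each point of the parameter plane [f] differs from an affine
    function, which contributes nothing, by [o] of the distance; the integral
    over a small rectangle is thus [o] of its squared perimeter. *)
Lemma boundary_integral_entire (f : C -> C) (z : C) (r a b c d : R) :
  entire f -> Cmod z < r -> a <= b -> c <= d ->
  boundary_integral (fun x t => f (cone z r x t)) (kappa z r) a b c d = 0.
Proof.
intros Hf Hr; assert (Z := Cmod_ge_0 z).
assert (Hk := ctn_kappa z r Hr).
assert (Hu := separately_ctn_cone f z r Hf ltac:(lra)).
revert a b c d; apply bisection_zero.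
- intros; now apply boundary_integral_split_x.
- intros; now apply boundary_integral_split_t.
- intros p q eps He.
  destruct (entire_linear_approx f (cone z r p q) Hf) as [l Hl].
  set (K := 1 + Cmod z / (r - Cmod z)).
  assert (HK : 0 < K).
  { unfold K; assert (0 <= Cmod z / (r - Cmod z)); [|lra].
    apply Rmult_le_pos; [easy|]; apply Rlt_le, Rinv_0_lt_compat; lra. }
  set (L := 2 * r * exp (p + 1)).
  assert (HL : 0 < L) by (assert (H := exp_pos (p + 1)); unfold L; nra).
  set (e' := eps / ((2 + 2 * K) * L)).
  assert (He' : 0 < e') by (apply Rdiv_lt_0_compat; [easy|nra]).
  destruct (Hl e' He') as (del & Hdel & H).
  exists (Rmin 1 (del / (4 * L))).
  split; [apply Rmin_pos; [lra|apply Rdiv_lt_0_compat; lra]|].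
  intros a b c d Hp Hq Hab Hcd.
  assert (Hab1 := Rle_trans _ _ _ Hab (Rmin_l _ _)).
  assert (Hab2 := Rle_trans _ _ _ Hab (Rmin_r _ _)).
  assert (Hcd2 := Rle_trans _ _ _ Hcd (Rmin_r _ _)).
  set (pt := cone z r p q) in *.
  set (A := (f pt - l * (pt - z))%C).
  assert (Haff := separately_ctn_affine z A l r ltac:(lra)).
  assert (E := boundary_integral_minus _ _ _ a b c d Hu Haff Hk).
  rewrite boundary_integral_affine in E by easy.
  replace (boundary_integral (fun x t => f (cone z r x t)) (kappa z r) a b c d)
    with (boundary_integral (fun x t => f (cone z r x t)
      - (A + l * (exp x * spoke z r t)))%C (kappa z r) a b c d)
    by (rewrite E; ring).
  set (s := (b - a) + (d - c)).
  replace (eps * s ^ 2) with ((2 + 2 * K) * (s * (e' * (L * s))))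
    by (unfold e'; field; split; lra).
  apply boundary_integral_bound; [|easy|lra|lra|lra| |].
  + destruct Hu as [U1 U2], Haff as [V1 V2].
    split; intros y; [now apply (ctn_minus (fun x => f (cone z r x y)))|].
    now apply (ctn_minus (fun t => f (cone z r y t))).
  + intros t; now apply kappa_bound.
  + intros x t Hx Ht.
    assert (X : Rabs (x - p) <= b - a) by (apply Rabs_le; lra).
    assert (T : Rabs (t - q) <= d - c) by (apply Rabs_le; lra).
    assert (Hc := cone_Lipschitz_near z r p q x t Hr ltac:(lra)); fold pt L in Hc.
    assert (Hs : L * (Rabs (x - p) + Rabs (t - q)) <= L * s)
      by (apply Rmult_le_compat_l; [lra|unfold s; lra]).
    assert (Hs' : L * s <= del / 2).
    { replace (del / 2) with (L * (del / (4 * L) + del / (4 * L))) by (field; lra).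
      apply Rmult_le_compat_l; [lra|unfold s; lra]. }
    specialize (H (cone z r x t) ltac:(lra)).
    replace (f (cone z r x t) - (A + l * (exp x * spoke z r t)))%C
      with (f (cone z r x t) - f pt - l * (cone z r x t - pt))%C
      by (unfold A, cone; ring).
    eapply Rle_trans; [exact H|]; apply Rmult_le_compat_l; lra.
Qed.

Lemma Cmod_le_all_eps (x : C) (K : R) :
  (forall eps, 0 < eps -> Cmod x <= K * eps) -> x = 0.
Proof.
intros H; apply Cmod_eq_0, Rle_antisym; [|apply Cmod_ge_0].
apply Rnot_lt_le; intros Hx.
assert (HK := Rabs_pos K); assert (HK' := Rle_abs K).
specialize (H (Cmod x / (2 * (Rabs K + 1))) ltac:(apply Rdiv_lt_0_compat; lra)).
assert (Cmod x = 2 * (Rabs K + 1) * (Cmod x / (2 * (Rabs K + 1)))) by (field; lra).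
assert (0 < Cmod x / (2 * (Rabs K + 1))) by (apply Rdiv_lt_0_compat; lra).
nra.
Qed.

(** The contours [x = 0] and [x = a] give the same integral, because the sides
    [t = 0] and [t = 2 PI] coincide; as [a] tends to minus infinity the contour
    shrinks to [z], where [f - f z] vanishes by continuity. *)
Lemma cauchy_formula (f : C -> C) (z : C) (r : R) : entire f -> Cmod z < r ->
  cint (fun t => (f (r * cis t) - f z) * kappa z r t)%C 0 (2 * PI) = 0.
Proof.
intros Hf Hr; assert (Z := Cmod_ge_0 z); assert (P := PI_RGT_0).
assert (Hk := ctn_kappa z r Hr).
destruct (separately_ctn_cone f z r Hf ltac:(lra)) as [U1 U2].
set (g := fun x t => ((f (cone z r x t) - f z) * kappa z r t)%C).
assert (Hg : forall x, ctn (g x)).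
{ intros x; apply (ctn_mult (fun t => f (cone z r x t) - f z)%C); [|easy].
  apply (ctn_minus (fun t => f (cone z r x t))); [apply U2|apply ctn_const]. }
assert (Hinv : forall a, a <= 0 -> cint (g 0) 0 (2 * PI) = cint (g a) 0 (2 * PI)).
{ intros a Ha.
  assert (E := boundary_integral_entire f z r a 0 0 (2 * PI) Hf Hr Ha ltac:(lra)).
  unfold boundary_integral in E.
  assert (Eg : forall x, cint (g x) 0 (2 * PI)
    = (cint (fun t => f (cone z r x t) * kappa z r t)%C 0 (2 * PI)
       - cint (fun t => f z * kappa z r t)%C 0 (2 * PI))%C).
  { intros x; rewrite <- cint_minus; [|now apply ctn_mult|now apply ctn_cmult].
    apply cint_ext; intros t; unfold g; ring. }
  rewrite !Eg.
  assert (Eper : cint (fun x => f (cone z r x 0)) a 0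
    = cint (fun x => f (cone z r x (2 * PI))) a 0).
  { apply cint_ext; intros x; unfold cone, spoke, cis.
    now rewrite cos_2PI, sin_2PI, cos_0, sin_0. }
  rewrite Eper in E.
  apply Ceq_minus; rewrite <- E; ring. }
replace (cint (fun t => (f (r * cis t) - f z) * kappa z r t)%C 0 (2 * PI))
  with (cint (g 0) 0 (2 * PI)).
2:{ apply cint_ext; intros t; unfold g, cone, spoke; rewrite exp_0.
    do 3 f_equal; ring. }
apply Cmod_le_all_eps with (2 * PI * (1 + Cmod z / (r - Cmod z))); intros eps He.
destruct (entire_continuous f z eps Hf He) as (d & Hd & H).
(* Shrink the contour to [z]. *)
set (a := Rmin 0 (ln (d / (4 * r)))).
assert (Ha : exp a * (2 * r) < d).
{ assert (Hln : exp a <= d / (4 * r)).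
  { rewrite <- (exp_ln (d / (4 * r))) by (apply Rdiv_lt_0_compat; lra).
    assert (H1 : a <= ln (d / (4 * r))) by apply Rmin_r.
    destruct H1 as [H1|H1]; [apply Rlt_le; now apply exp_increasing|rewrite H1; lra]. }
  apply Rle_lt_trans with (d / (4 * r) * (2 * r)); [apply Rmult_le_compat_r; lra|].
  replace (d / (4 * r) * (2 * r)) with (d / 2) by (field; lra); lra. }
rewrite (Hinv a) by apply Rmin_l.
replace (2 * PI * (1 + Cmod z / (r - Cmod z)) * eps)
  with ((2 * PI - 0) * (eps * (1 + Cmod z / (r - Cmod z)))) by ring.
apply cint_bound; [apply Hg|lra|]; intros t _; unfold g; rewrite Cmod_mult.
apply Rmult_le_compat; auto using Cmod_ge_0, kappa_bound.
apply Rlt_le, H.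
unfold cone; replace (z + exp a * spoke z r t - z)%C with (exp a * spoke z r t)%C by ring.
rewrite Cmod_mult, Cmod_R, Rabs_pos_eq by apply Rlt_le, exp_pos.
eapply Rle_lt_trans; [|exact Ha]; apply Rmult_le_compat_l; [apply Rlt_le, exp_pos|].
eapply Rle_trans; [apply spoke_upper|]; lra.
Qed.

(** * Polynomials as lists of coefficients *)

Fixpoint peval (l : list C) (z : C) : C :=
  match l with nil => RtoC 0 | c :: l => (c + z * peval l z)%C end.

Fixpoint pderiv (l : list C) (z : C) : C :=
  match l with nil => RtoC 0 | c :: l => (peval l z + z * pderiv l z)%C end.

Fixpoint pnorm (l : list C) : R :=
  match l with nil => 0 | c :: l => Cmod c + pnorm l end.

Fixpoint padd (l m : list C) : list C :=
  match l, m with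
  | nil, _ => m
  | _, nil => l
  | c :: l, d :: m => (c + d)%C :: padd l m
  end.

Definition pscale (a : C) (l : list C) : list C := map (Cmult a) l.

Fixpoint pmul (l m : list C) : list C :=
  match l with nil => nil | c :: l => padd (pscale c m) (RtoC 0 :: pmul l m) end.

(** Taylor shift: the polynomial [z |-> l (z - a)]. *)
Fixpoint pshift (a : C) (l : list C) : list C :=
  match l with
  | nil => nil
  | c :: l => padd (c :: nil) (pmul ((- a)%C :: RtoC 1 :: nil) (pshift a l))
  end.

Lemma peval_padd l m z : peval (padd l m) z = (peval l z + peval m z)%C.
Proof.
revert m; induction l as [|c l IH]; intros [|d m]; cbn; try ring.
rewrite IH; ring.
Qed.

Lemma pderiv_padd l m z : pderiv (padd l m) z = (pderiv l z + pderiv m z)%C.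
Proof.
revert m; induction l as [|c l IH]; intros [|d m]; cbn; try ring.
rewrite IH, peval_padd; ring.
Qed.

Lemma peval_pscale a l z : peval (pscale a l) z = (a * peval l z)%C.
Proof. induction l as [|c l IH]; cbn; [ring|]; unfold pscale in IH; rewrite IH; ring. Qed.

Lemma peval_pmul l m z : peval (pmul l m) z = (peval l z * peval m z)%C.
Proof.
induction l as [|c l IH]; cbn -[padd]; [ring|].
rewrite peval_padd, peval_pscale; cbn; rewrite IH; ring.
Qed.

Lemma peval_pshift a l z : peval (pshift a l) z = peval l (z - a)%C.
Proof.
induction l as [|c l IH]; [easy|].
cbn -[padd pmul]; rewrite peval_padd, peval_pmul, IH; cbn; ring.
Qed.

Lemma pnorm_ge_0 l : 0 <= pnorm l.
Proof. induction l as [|c l IH]; cbn; [lra|]; assert (H := Cmod_ge_0 c); lra. Qed.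

Lemma pnorm_padd l m : pnorm (padd l m) <= pnorm l + pnorm m.
Proof.
revert m; induction l as [|c l IH]; intros [|d m]; cbn; try lra.
assert (H := Cmod_triangle c d); specialize (IH m); lra.
Qed.

Lemma pnorm_pscale a l : pnorm (pscale a l) = Cmod a * pnorm l.
Proof.
induction l as [|c l IH]; cbn; [ring|]; unfold pscale in IH; rewrite IH, Cmod_mult; ring.
Qed.

Lemma pnorm_pmul l m : pnorm (pmul l m) <= pnorm l * pnorm m.
Proof.
induction l as [|c l IH]; cbn -[padd]; [lra|].
eapply Rle_trans; [apply pnorm_padd|].
rewrite pnorm_pscale; cbn; rewrite Cmod_0; lra.
Qed.

Lemma pnorm_pshift a l : pnorm (pshift a l) <= pnorm l * (Cmod a + 1) ^ length l.
Proof.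
assert (HA := Cmod_ge_0 a).
induction l as [|c l IH]; [cbn; lra|].
cbn -[padd pmul]; eapply Rle_trans; [apply pnorm_padd|].
assert (H := pnorm_pmul ((- a)%C :: RtoC 1 :: nil) (pshift a l)).
cbn [pnorm] in *; rewrite Cmod_opp, Cmod_1 in H.
assert (HP : 1 <= (Cmod a + 1) ^ length l) by (apply pow_R1_Rle; lra).
assert (HC := Cmod_ge_0 c); assert (HN := pnorm_ge_0 l).
assert (H1 : (Cmod a + (1 + 0)) * pnorm (pshift a l)
  <= (Cmod a + 1) * (pnorm l * (Cmod a + 1) ^ length l))
  by (rewrite Rplus_0_r; apply Rmult_le_compat_l; lra).
assert (1 <= (Cmod a + 1) * (Cmod a + 1) ^ length l) by nra.
nra.
Qed.

Lemma length_padd l m : length (padd l m) = Nat.max (length l) (length m).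
Proof.
revert m; induction l as [|c l IH]; intros [|d m]; cbn; try lia.
now rewrite IH.
Qed.

Lemma length_pscale a l : length (pscale a l) = length l.
Proof. apply length_map. Qed.

Lemma length_pmul l m : (length (pmul l m) <= length l + length m)%nat.
Proof.
induction l as [|c l IH]; cbn -[padd]; [lia|].
rewrite length_padd, length_pscale; cbn; lia.
Qed.

Lemma length_pshift a l : (length (pshift a l) <= 2 * length l)%nat.
Proof.
induction l as [|c l IH]; [easy|].
cbn -[padd pmul Nat.mul]; rewrite length_padd.
assert (H := length_pmul ((- a)%C :: RtoC 1 :: nil) (pshift a l)).
cbn [length] in *; lia.
Qed.

(** The values, the derivative and the second order Taylor remainder obey the
    same bound, which is what lets one smallness condition control all three. *)
Lemma peval_bound l z r : Cmod z <= r ->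
  Cmod (peval l z) <= pnorm l * (r + 1) ^ length l.
Proof.
intros Hz; assert (Z := Cmod_ge_0 z).
induction l as [|c l IH]; cbn; [rewrite Cmod_0; lra|].
eapply Rle_trans; [apply Cmod_triangle|]; rewrite Cmod_mult.
assert (HP : 1 <= (r + 1) ^ length l) by (apply pow_R1_Rle; lra).
assert (HC := Cmod_ge_0 c); assert (HN := pnorm_ge_0 l).
assert (HE := Cmod_ge_0 (peval l z)).
assert (Cmod z * Cmod (peval l z) <= r * (pnorm l * (r + 1) ^ length l))
  by now apply Rmult_le_compat.
assert (1 <= (r + 1) * (r + 1) ^ length l) by nra.
assert (0 <= pnorm l * (r + 1) ^ length l) by nra.
nra.
Qed.

Lemma pderiv_bound l z r : Cmod z <= r ->
  Cmod (pderiv l z) <= pnorm l * (r + 1) ^ length l.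
Proof.
intros Hz; assert (Z := Cmod_ge_0 z).
induction l as [|c l IH]; cbn; [rewrite Cmod_0; lra|].
eapply Rle_trans; [apply Cmod_triangle|]; rewrite Cmod_mult.
assert (HB := peval_bound l z r Hz).
assert (HP : 1 <= (r + 1) ^ length l) by (apply pow_R1_Rle; lra).
assert (HC := Cmod_ge_0 c).
assert (Cmod z * Cmod (pderiv l z) <= r * (pnorm l * (r + 1) ^ length l))
  by (apply Rmult_le_compat; auto using Cmod_ge_0).
assert (0 <= Cmod c * ((r + 1) * (r + 1) ^ length l)) by (repeat apply Rmult_le_pos; lra).
nra.
Qed.

Lemma premainder_bound l z w r : Cmod z <= r -> Cmod w <= r ->
  Cmod (peval l w - peval l z - (w - z) * pderiv l z)%C
  <= pnorm l * (r + 1) ^ length l * Cmod (w - z)%C ^ 2.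
Proof.
intros Hz Hw; assert (Z := Cmod_ge_0 z).
induction l as [|c l IH]; cbn -[pow].
{ replace (RtoC 0 - RtoC 0 - (w - z) * RtoC 0)%C with (RtoC 0) by ring.
  rewrite Cmod_0; lra. }
replace (c + w * peval l w - (c + z * peval l z)
    - (w - z) * (peval l z + z * pderiv l z))%C
  with (w * (peval l w - peval l z - (w - z) * pderiv l z)
    + (w - z) * (w - z) * pderiv l z)%C by ring.
eapply Rle_trans; [apply Cmod_triangle|]; rewrite !Cmod_mult.
rewrite <- tech_pow_Rmult.
assert (HB := pderiv_bound l z r Hz).
assert (HP : 1 <= (r + 1) ^ length l) by (apply pow_R1_Rle; lra).
assert (HC := Cmod_ge_0 c).
set (h := Cmod (w - z)%C) in *; set (B := pnorm l * (r + 1) ^ length l) in *.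
assert (H1 : Cmod w * Cmod (peval l w - peval l z - (w - z) * pderiv l z)%C
  <= r * (B * h ^ 2)) by (apply Rmult_le_compat; auto using Cmod_ge_0).
assert (H2 : h * h * Cmod (pderiv l z) <= h ^ 2 * B).
{ replace (h ^ 2) with (h * h) by ring; apply Rmult_le_compat_l; [nra|easy]. }
assert (H3 : 0 <= Cmod c * ((r + 1) * (r + 1) ^ length l) * h ^ 2).
{ apply Rmult_le_pos; [repeat apply Rmult_le_pos; lra|apply pow2_ge_0]. }
replace ((Cmod c + pnorm l) * ((r + 1) * (r + 1) ^ length l) * h ^ 2)
  with (Cmod c * ((r + 1) * (r + 1) ^ length l) * h ^ 2 + (r * (B * h ^ 2) + h ^ 2 * B))
  by (unfold B; ring).
lra.
Qed.

Lemma peval_Lipschitz l z w r : Cmod z <= r -> Cmod w <= r ->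
  Cmod (peval l w - peval l z)%C <= pnorm l * (r + 1) ^ length l * Cmod (w - z)%C.
Proof.
intros Hz Hw; assert (Z := Cmod_ge_0 z).
induction l as [|c l IH]; cbn.
{ replace (RtoC 0 - RtoC 0)%C with (RtoC 0) by ring; rewrite Cmod_0; lra. }
replace (c + w * peval l w - (c + z * peval l z))%C
  with (w * (peval l w - peval l z) + (w - z) * peval l z)%C by ring.
eapply Rle_trans; [apply Cmod_triangle|]; rewrite !Cmod_mult.
assert (HB := peval_bound l z r Hz).
assert (HP : 1 <= (r + 1) ^ length l) by (apply pow_R1_Rle; lra).
assert (HC := Cmod_ge_0 c).
set (h := Cmod (w - z)%C) in *; set (B := pnorm l * (r + 1) ^ length l) in *.
assert (Hh : 0 <= h) by apply Cmod_ge_0.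
assert (H1 : Cmod w * Cmod (peval l w - peval l z)%C <= r * (B * h))
  by (apply Rmult_le_compat; auto using Cmod_ge_0).
assert (H2 : h * Cmod (peval l z) <= h * B) by now apply Rmult_le_compat_l.
assert (H3 : 0 <= Cmod c * ((r + 1) * (r + 1) ^ length l) * h)
  by (repeat apply Rmult_le_pos; lra).
replace ((Cmod c + pnorm l) * ((r + 1) * (r + 1) ^ length l) * h)
  with (Cmod c * ((r + 1) * (r + 1) ^ length l) * h + (r * (B * h) + h * B))
  by (unfold B; ring).
lra.
Qed.

(** * Polynomials are dense in the entire functions *)

Lemma cis_pow (t : R) (n : nat) : (cis t ^ n)%C = cis (INR n * t).
Proof.
induction n as [|n IH].
- cbn; unfold cis; rewrite Rmult_0_l, cos_0, sin_0; reflexivity.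
- rewrite Cpow_S, IH, S_INR, Rmult_plus_distr_r, Rmult_1_l.
  unfold cis; rewrite cos_plus, sin_plus.
  apply injective_projections; cbn; ring.
Qed.

Lemma peval_geometric (b z : C) (k N : nat) :
  (peval (map (fun n => b ^ n) (seq k N)) z * (1 - b * z)
   = b ^ k * (1 - (b * z) ^ N))%C.
Proof.
revert k; induction N as [|N IH]; intros k; cbn [seq map peval]; [cbn; ring|].
replace ((b ^ k + z * peval (map (fun n => b ^ n) (seq (S k) N)) z) * (1 - b * z))%C
  with (b ^ k * (1 - b * z)
    + z * (peval (map (fun n => b ^ n) (seq (S k) N)) z * (1 - b * z)))%C by ring.
rewrite IH, !Cpow_S; ring.
Qed.

Lemma ctn_cis_opp (r : R) : ctn (fun t => cis (- t) / r)%C.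
Proof.
apply (ctn_mult (fun t => cis (- t)) (fun _ => / r)%C); [|apply ctn_const].
apply ctn_Lipschitz with 2; intros s t.
eapply Rle_trans; [apply cis_Lipschitz|].
replace (- s - - t) with (- (s - t)) by ring; rewrite Rabs_Ropp; lra.
Qed.

Lemma ctn_pow (u : R -> C) (n : nat) : ctn u -> ctn (fun t => u t ^ n)%C.
Proof.
intros Hu; induction n as [|n IH]; [apply (ctn_const 1)|].
apply (ctn_mult u (fun t => u t ^ n)%C Hu IH).
Qed.

Lemma ctn_peval (w : nat -> R -> C) (s : list nat) (z : C) : (forall n, ctn (w n)) ->
  ctn (fun t => peval (map (fun n => w n t) s) z).
Proof.
intros Hw; induction s as [|n s IH]; cbn; [apply ctn_const|].
apply ctn_plus; [easy|]; now apply ctn_cmult.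
Qed.

Lemma cint_peval (g : R -> C) (w : nat -> R -> C) (s : list nat) (z : C) (a b : R) :
  ctn g -> (forall n, ctn (w n)) ->
  cint (fun t => g t * peval (map (fun n => w n t) s) z)%C a b
  = peval (map (fun n => cint (fun t => g t * w n t)%C a b) s) z.
Proof.
intros Hg Hw; induction s as [|n s IH]; cbn [map peval].
- rewrite (cint_ext _ (fun t => RtoC 0 * g t)%C) by (intros; ring).
  rewrite cint_cmult by easy; ring.
- rewrite (cint_ext _ (fun t => g t * w n t
     + z * (g t * peval (map (fun n => w n t) s) z))%C) by (intros; ring).
  assert (H : ctn (fun t => g t * peval (map (fun n => w n t) s) z)%C)
    by (apply ctn_mult; [easy|now apply ctn_peval]).
  rewrite cint_plus; [|now apply ctn_mult|now apply ctn_cmult].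
  now rewrite cint_cmult, IH.
Qed.

Lemma cint_cis_pow (r : R) (n : nat) : 0 < r -> (0 < n)%nat ->
  cint (fun t => (cis (- t) / r) ^ n)%C 0 (2 * PI) = 0.
Proof.
intros Hr Hn.
assert (Hn' : INR n <> 0) by (apply not_0_INR; lia).
assert (Hr' : RtoC r <> 0) by (intros E; apply RtoC_inj in E; lra).
rewrite (cint_ext _ (fun t => (/ r) ^ n * cis (- t) ^ n)%C)
  by (intros t; unfold Cdiv; rewrite Cpow_mult_l; ring).
assert (Hc : ctn (fun t => cis (- t) ^ n)%C).
{ apply ctn_pow; apply ctn_Lipschitz with 2; intros s t.
  eapply Rle_trans; [apply cis_Lipschitz|].
  replace (- s - - t) with (- (s - t)) by ring; rewrite Rabs_Ropp; lra. }
rewrite cint_cmult by easy.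
rewrite (cint_derive (fun t : R => (- sin (INR n * - t) / INR n, cos (INR n * - t) / INR n)%R)).
- assert (E : sin (INR n * - (2 * PI)) = 0 /\ cos (INR n * - (2 * PI)) = 1).
  { replace (INR n * - (2 * PI)) with (- (0 + 2 * INR n * PI)) by ring.
    now rewrite sin_neg, cos_neg, sin_period, cos_period, sin_0, cos_0, Ropp_0. }
  destruct E as [-> ->]; rewrite Ropp_0, Rmult_0_r, sin_0, cos_0.
  apply injective_projections; cbn; field; easy.
- easy.
- intros t; rewrite cis_pow; cbn; auto_derive; [easy|]; field; easy.
- intros t; rewrite cis_pow; cbn; auto_derive; [easy|]; field; easy.
Qed.

Lemma ctn_bounded (u : R -> C) (a b : R) : ctn u -> a <= b ->
  exists M, forall t, a <= t <= b -> Cmod (u t) <= M.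
Proof.
intros Hu Hab.
destruct (continuity_ab_maj (fun t => Cmod (u t)) a b Hab) as (x & Hx & _).
- intros t _ eps He; destruct (Hu t eps He) as (d & Hd & H).
  exists d; split; [easy|]; intros s [_ Hs]; specialize (H s Hs).
  eapply Rle_lt_trans; [|exact H]; apply Rabs_le.
  assert (H1 := Cmod_le_add (u s) (u t)); assert (H2 := Cmod_le_add (u t) (u s)).
  rewrite (Cmod_minus_sym (u t)) in H2; lra.
- exists (Cmod (u x)); intros t Ht; now apply Hx.
Qed.

(** The coefficients are the averages of [f(w) / w^n] over the circle of radius
    [r], with [1/w] written as [cis (- t) / r]. *)
Definition taylor_poly (f : C -> C) (r : R) (N : nat) : list C :=
  pscale (/ (2 * PI)) (map (fun n =>
    cint (fun t => f (r * cis t) * (cis (- t) / r) ^ n)%C 0 (2 * PI)) (seq 0 N)).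

Lemma kappa_geometric (z : C) (r t : R) (N : nat) : Cmod z < r ->
  kappa z r t
  = (Ci * peval (map (fun n => (cis (- t) / r) ^ n) (seq 0 N)) z
     + (cis (- t) / r * z) ^ N * kappa z r t)%C.
Proof.
intros Hr; assert (Z := Cmod_ge_0 z).
assert (Hr' : RtoC r <> 0) by (intros E; apply RtoC_inj in E; lra).
set (b := (cis (- t) / r)%C).
assert (Hb : (b * (r * cis t))%C = 1).
{ unfold b; transitivity (cis (- t) * cis t)%C; [field; easy|].
  unfold cis; rewrite cos_neg, sin_neg.
  assert (H := sin2_cos2 t); unfold Rsqr in H.
  apply injective_projections; cbn; [rewrite <- H|]; ring. }
assert (Hk : (kappa z r t * (1 - b * z))%C = Ci).
{ transitivity (b * (spoke z r t * kappa z r t))%C.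
  - rewrite <- Hb; unfold spoke; ring.
  - rewrite spoke_kappa by easy.
    transitivity (Ci * (b * (r * cis t)))%C; [ring|rewrite Hb; ring]. }
assert (G := peval_geometric b z 0 N).
cbn [Cpow] in G; rewrite Cmult_1_l in G.
rewrite <- Hk.
transitivity (kappa z r t * (peval (map (fun n => b ^ n)%C (seq 0 N)) z * (1 - b * z))
  + (b * z) ^ N * kappa z r t)%C; [rewrite G; ring|ring].
Qed.

(** Apply Cauchy's formula to [f - f z] and expand the kernel: the first [N] terms
    are the polynomial minus [f z], the remainder is a geometric tail of ratio at
    most [1/2].  Keeping [f z] on the right makes the estimate usable to bound
    [f] itself on the disc. *)
Lemma taylor_poly_error (f : C -> C) (z : C) (r M : R) (N : nat) :
  entire f -> 2 * Cmod z <= r -> 0 < r -> (0 < N)%nat ->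
  (forall t, 0 <= t <= 2 * PI -> Cmod (f (r * cis t)%C) <= M) ->
  Cmod (f z - peval (taylor_poly f r N) z)%C <= (M + Cmod (f z)) * (2 * (/ 2) ^ N).
Proof.
intros Hf Hz Hr HN HM.
assert (Z := Cmod_ge_0 z); assert (P := PI_RGT_0).
assert (Hzr : Cmod z < r) by lra.
assert (HP : RtoC (2 * PI) <> 0) by (intros E; apply RtoC_inj in E; lra).
set (b := fun t => (cis (- t) / r)%C).
set (S := fun t => peval (map (fun n => b t ^ n)%C (seq 0 N)) z).
set (err := fun t => (((f (r * cis t) - f z)) * ((b t * z) ^ N * kappa z r t))%C).
assert (Hb : ctn b) by apply ctn_cis_opp.
assert (Hbn : forall n, ctn (fun t => b t ^ n)%C) by (intros; now apply ctn_pow).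
assert (HS : ctn S) by (apply (ctn_peval (fun n t => b t ^ n)%C); auto).
assert (Hk := ctn_kappa z r Hzr).
assert (Hfr : ctn (fun t => f (r * cis t)%C)).
{ apply ctn_comp_entire; [easy|]; apply ctn_cmult.
  apply ctn_Lipschitz with 2, cis_Lipschitz. }
assert (Hfz : ctn (fun t => f (r * cis t) - f z)%C)
  by (apply ctn_minus; [easy|apply ctn_const]).
assert (Herr : ctn err).
{ unfold err; apply ctn_mult; [easy|]; apply ctn_mult; [|easy].
  apply ctn_pow, (ctn_mult b (fun _ => z)); [easy|apply ctn_const]. }
assert (HC := cauchy_formula f z r Hf Hzr).
rewrite (cint_ext _ (fun t => Ci * ((f (r * cis t) - f z) * S t) + err t)%C) in HC.
2:{ intros t; rewrite (kappa_geometric z r t N Hzr) at 1; unfold S, err, b; ring. }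
assert (HfS : ctn (fun t => (f (r * cis t) - f z) * S t)%C) by now apply ctn_mult.
assert (HfS' : ctn (fun t => f (r * cis t) * S t)%C) by now apply ctn_mult.
assert (HzS : ctn (fun t => f z * S t)%C) by now apply ctn_cmult.
rewrite cint_plus, cint_cmult in HC by (easy || now apply ctn_cmult).
rewrite (cint_ext (fun t => (f (r * cis t) - f z) * S t)%C
  (fun t => f (r * cis t) * S t - f z * S t)%C) in HC by (intros; ring).
rewrite cint_minus, cint_cmult in HC by easy.
(* The truncated kernel has mean value one: only its constant term counts. *)
assert (HS1 : cint S 0 (2 * PI) = RtoC (2 * PI)).
{ rewrite (cint_ext S (fun t => 1 * S t)%C) by (intros; ring).
  unfold S; rewrite (cint_peval (fun _ => RtoC 1) (fun n t => b t ^ n)%C)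
    by auto using ctn_const.
  destruct N as [|N]; [lia|]; cbn [seq map peval].
  assert (H0 : forall k, peval (map (fun n =>
    cint (fun t => 1 * b t ^ n)%C 0 (2 * PI)) (seq (Datatypes.S k) N)) z = RtoC 0).
  { clear - Hr; induction N as [|N IH]; intros k; cbn [seq map peval]; [easy|].
    rewrite IH, (cint_ext _ (fun t => b t ^ Datatypes.S k)%C) by (intros; ring).
    unfold b; rewrite cint_cis_pow by (easy || lia); ring. }
  rewrite H0, (cint_derive (fun t => RtoC t)).
  - rewrite RtoC_mult; ring.
  - apply ctn_cmult, Hbn.
  - intros t; cbn; auto_derive; [easy|ring].
  - intros t; cbn; auto_derive; [easy|ring]. }
rewrite HS1 in HC.
assert (HT : cint (fun t => f (r * cis t) * S t)%C 0 (2 * PI)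
  = (2 * PI * peval (taylor_poly f r N) z)%C).
{ unfold taylor_poly, S; rewrite peval_pscale, cint_peval by auto.
  unfold b; field; intros E; apply RtoC_inj in E; lra. }
rewrite HT in HC.
assert (HE : Cmod (cint err 0 (2 * PI))
  <= (2 * PI - 0) * ((M + Cmod (f z)) * ((/ 2) ^ N * 2))).
{ apply cint_bound; [easy|lra|]; intros t Ht; unfold err.
  rewrite !Cmod_mult, Cmod_pow, Cmod_mult.
  apply Rmult_le_compat; auto using Cmod_ge_0.
  - apply Rmult_le_pos; [apply pow_le, Rmult_le_pos|]; apply Cmod_ge_0.
  - specialize (HM t Ht); unfold Cminus; eapply Rle_trans; [apply Cmod_triangle|].
    rewrite Cmod_opp; lra.
  - apply Rmult_le_compat; auto using Cmod_ge_0.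
    + apply pow_le, Rmult_le_pos; apply Cmod_ge_0.
    + apply pow_incr; split; [apply Rmult_le_pos; apply Cmod_ge_0|].
      unfold b; rewrite Cmod_div, Cmod_cis, Cmod_R, Rabs_pos_eq;
        [|lra|intros E; apply RtoC_inj in E; lra].
      apply Rmult_le_reg_l with r; [easy|].
      replace (r * (1 / r * Cmod z)) with (Cmod z) by (field; lra); lra.
    + eapply Rle_trans; [now apply kappa_bound|].
      assert (Cmod z / (r - Cmod z) <= 1); [|lra].
      apply Rmult_le_reg_r with (r - Cmod z); [lra|].
      unfold Rdiv; rewrite Rmult_assoc, Rinv_l; lra. }
assert (HD : (2 * PI * (f z - peval (taylor_poly f r N) z)
  = - Ci * cint err 0 (2 * PI))%C).
{ assert (E : (Ci * (Ci * (2 * PI * peval (taylor_poly f r N) z - f z * RtoC (2 * PI)))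
    + Ci * cint err 0 (2 * PI) = Ci * 0)%C).
  { rewrite <- HC; ring. }
  assert (I : (Ci * Ci)%C = (- (1))%C)
    by (apply injective_projections; cbn; ring).
  rewrite RtoC_mult in E.
  transitivity ((Ci * (Ci * (2 * PI * peval (taylor_poly f r N) z - f z * (2 * PI)))
    + Ci * cint err 0 (2 * PI)) - Ci * cint err 0 (2 * PI))%C; [|rewrite E; ring].
  rewrite Cmult_assoc, I; ring. }
apply Rmult_le_reg_l with (2 * PI); [lra|].
apply (f_equal Cmod) in HD.
rewrite !Cmod_mult, Cmod_opp, Cmod_Ci, !Cmod_R, !Rabs_pos_eq in HD by lra.
rewrite HD; lra.
Qed.

Lemma entire_polynomial_approx (f : C -> C) (rho eps : R) : entire f -> 0 < eps ->
  exists l, forall z, Cmod z <= rho -> Cmod (f z - peval l z)%C <= eps.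
Proof.
intros Hf He.
set (r := 2 * Rabs rho + 1).
assert (Hr : 0 < r) by (assert (H := Rabs_pos rho); unfold r; lra).
assert (Hfr : ctn (fun t => f (r * cis t)%C)).
{ apply ctn_comp_entire; [easy|]; apply ctn_cmult.
  apply ctn_Lipschitz with 2, cis_Lipschitz. }
destruct (ctn_bounded _ 0 (2 * PI) Hfr) as [M HM]; [assert (P := PI_RGT_0); lra|].
assert (M0 : 0 <= M).
{ eapply Rle_trans; [apply Cmod_ge_0|apply (HM 0)]; assert (P := PI_RGT_0); lra. }
assert (Hz : forall z, Cmod z <= rho -> 2 * Cmod z <= r /\ Cmod z <= r).
{ intros z Hz; assert (H := Rle_abs rho); assert (H' := Rabs_pos rho); unfold r; lra. }
(* The second partial sum already gives an a priori bound for [f] on the disc. *)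
set (p2 := taylor_poly f r 2).
set (B := 2 * (pnorm p2 * (r + 1) ^ length p2) + M).
assert (HB : forall z, Cmod z <= rho -> Cmod (f z) <= B).
{ intros z H; destruct (Hz z H) as [H1 H2].
  assert (E := taylor_poly_error f z r M 2 Hf H1 Hr ltac:(lia) HM).
  assert (E1 := Cmod_le_add (f z) (peval p2 z)).
  assert (E2 := peval_bound p2 z r H2).
  fold p2 in E; cbn [pow] in E; unfold B; lra. }
assert (HMB : 0 < 2 * (M + Rabs B + 1)) by (assert (H := Rabs_pos B); lra).
destruct (pow_lt_1_zero (/ 2) ltac:(rewrite Rabs_right; lra)
  (eps / (2 * (M + Rabs B + 1))) ltac:(now apply Rdiv_lt_0_compat)) as [N HN].
specialize (HN (S N) ltac:(lia)).
rewrite Rabs_right in HN by (apply Rle_ge, pow_le; lra).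
apply (Rmult_lt_compat_l _ _ _ HMB) in HN.
replace (2 * (M + Rabs B + 1) * (eps / (2 * (M + Rabs B + 1)))) with eps in HN
  by (field; lra).
exists (taylor_poly f r (S N)); intros z H; destruct (Hz z H) as [H1 _].
eapply Rle_trans; [apply (taylor_poly_error f z r M (S N) Hf H1 Hr ltac:(lia) HM)|].
specialize (HB z H); assert (HB' := Rle_abs B).
assert (HP : 0 < (/ 2) ^ S N) by (apply pow_lt; lra).
nra.
Qed.

(** * Prescribing a polynomial near a far away point *)

Definition monomial (c : C) (n : nat) : list C := repeat (RtoC 0) n ++ c :: nil.

Lemma peval_monomial c n z : peval (monomial c n) z = (c * z ^ n)%C.
Proof.
unfold monomial; induction n as [|n IH]; cbn; [ring|]; rewrite IH; ring.
Qed.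

Lemma pnorm_monomial c n : pnorm (monomial c n) = Cmod c.
Proof.
unfold monomial; induction n as [|n IH]; cbn; [ring|]; rewrite IH, Cmod_0; ring.
Qed.

Lemma length_monomial c n : length (monomial c n) = S n.
Proof. unfold monomial; rewrite length_app, repeat_length; cbn; lia. Qed.

(** The coefficient list of [1 - (1 - y)^D]: it takes values close to [1] where
    [y] is close to [1], to order [D], and has small coefficients if [y] has. *)
Fixpoint plateau (y : list C) (D : nat) : list C :=
  match D with
  | O => nil
  | S D => padd y (pmul (padd (RtoC 1 :: nil) (pscale (- (1)) y)) (plateau y D))
  end.

Lemma peval_plateau y D z :
  (1 - peval (plateau y D) z = (1 - peval y z) ^ D)%C.
Proof.
induction D as [|D IH]; [cbn; ring|].
cbn -[padd pmul]; rewrite peval_padd, peval_pmul, peval_padd, peval_pscale, <- IH.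
cbn; ring.
Qed.

Lemma pnorm_plateau y D : pnorm y <= 1 -> pnorm (plateau y D) <= (2 ^ D - 1) * pnorm y.
Proof.
intros Hy; assert (Y := pnorm_ge_0 y).
induction D as [|D IH]; [cbn; lra|].
cbn -[padd pmul]; eapply Rle_trans; [apply pnorm_padd|].
assert (H1 := pnorm_pmul (padd (RtoC 1 :: nil) (pscale (- (1)) y)) (plateau y D)).
assert (H2 := pnorm_padd (RtoC 1 :: nil) (pscale (- (1)) y)).
rewrite pnorm_pscale, Cmod_m1 in H2; cbn [pnorm] in H2; rewrite Cmod_1 in H2.
assert (H3 := pnorm_ge_0 (plateau y D)).
assert (H4 : pnorm (padd (RtoC 1 :: nil) (pscale (- (1)) y)) <= 2) by lra.
apply (Rmult_le_compat_r _ _ _ H3) in H4.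
lra.
Qed.

Lemma length_plateau y D : y <> nil -> (length (plateau y D) <= D * length y)%nat.
Proof.
intros Hy; induction D as [|D IH]; [easy|].
cbn [plateau]; rewrite length_padd.
assert (H := length_pmul (padd (RtoC 1 :: nil) (pscale (- (1)) y)) (plateau y D)).
rewrite length_padd, length_pscale in H.
assert (H0 : (0 < length y)%nat) by (destruct y; [easy|cbn; lia]).
cbn [length] in H; lia.
Qed.

Lemma Cmod_pow_near_1 (u : C) (N : nat) : Cmod u <= 1 ->
  Cmod (1 - (1 + u) ^ N)%C <= Cmod u * 2 ^ N.
Proof.
intros Hu; assert (U := Cmod_ge_0 u).
induction N as [|N IH].
- cbn; replace (1 - 1)%C with (RtoC 0) by ring; rewrite Cmod_0; lra.
- rewrite Cpow_S.
  replace (1 - (1 + u) * (1 + u) ^ N)%C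
    with ((1 - (1 + u) ^ N) + - u * (1 + u) ^ N)%C by ring.
  eapply Rle_trans; [apply Cmod_triangle|].
  rewrite Cmod_mult, Cmod_opp, Cmod_pow; cbn [pow].
  assert (H1 : Cmod (1 + u)%C <= 2).
  { eapply Rle_trans; [apply Cmod_triangle|]; rewrite Cmod_1; lra. }
  assert (H2 : Cmod (1 + u)%C ^ N <= 2 ^ N) by (apply pow_incr; split; [apply Cmod_ge_0|easy]).
  nra.
Qed.

Lemma exists_large_nat (X : R) : exists n : nat, X <= INR n.
Proof. destruct (INR_unbounded X) as [n Hn]; exists n; lra. Qed.

Lemma pow_div_succ (x : R) (m : nat) : 0 < x -> x ^ m * / x ^ S m = / x.
Proof.
intros Hx; assert (H := pow_lt x m Hx); cbn; field; split; lra.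
Qed.

(** The degree bound [d] comes before [eta] and [eps]: any requirement on [g] that
    is a smallness condition depending on the degree can then be met by a
    suitable [eta].  The point [INR n * a] is far away, and
    [g = (P(z - n a) - G(z)) (1 - (1 - (z / (n a))^D)^D)]. *)
Lemma polynomial_correction (G P : list C) (a : C) (R0 : R) :
  Cmod a = 1 -> 0 <= R0 ->
  exists d : nat, forall eta eps, 0 < eta -> 0 < eps ->
  exists (n : nat) (g : list C),
    (length g <= d)%nat /\ pnorm g <= eta /\
    forall w, Cmod w <= R0 ->
      Cmod (peval G (w + INR n * a) + peval g (w + INR n * a) - peval P w)%C <= eps.
Proof.
intros Ha HR.
set (m := (length G + length P)%nat); set (D := S m).
exists (2 * length P + length G + D * S D)%nat; intros eta eps Heta Heps.
(* The two errors turn out to be at most [C1 / n] and [C2 / n]. *)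
set (C1 := (pnorm P * 2 ^ D + pnorm G) * 2 ^ D).
set (C2 := (pnorm G + pnorm P) * 3 ^ m * (R0 * 2 ^ D) ^ D).
assert (NG := pnorm_ge_0 G); assert (NP := pnorm_ge_0 P).
assert (P2 : 0 < 2 ^ D) by (apply pow_lt; lra).
destruct (exists_large_nat (Rmax (R0 + 1) (Rmax (C1 / eta) (C2 / eps)))) as [n Hn].
set (x := INR n) in *.
assert (Hx1 : R0 + 1 <= x) by (eapply Rle_trans; [apply Rmax_l|exact Hn]).
assert (Hx2 : C1 / eta <= x).
{ eapply Rle_trans; [|exact Hn]; eapply Rle_trans; [apply Rmax_l|apply Rmax_r]. }
assert (Hx3 : C2 / eps <= x).
{ eapply Rle_trans; [|exact Hn]; eapply Rle_trans; [apply Rmax_r|apply Rmax_r]. }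
assert (Hx : 0 < x) by lra.
assert (HC1 : C1 * / x <= eta).
{ apply Rmult_le_reg_r with x; [easy|].
  rewrite Rmult_assoc, Rinv_l, Rmult_1_r by lra.
  apply Rmult_le_compat_l with (r := eta) in Hx2; [|lra].
  now replace (eta * (C1 / eta)) with C1 in Hx2 by (field; lra). }
assert (HC2 : C2 * / x <= eps).
{ apply Rmult_le_reg_r with x; [easy|].
  rewrite Rmult_assoc, Rinv_l, Rmult_1_r by lra.
  apply Rmult_le_compat_l with (r := eps) in Hx3; [|lra].
  now replace (eps * (C2 / eps)) with C2 in Hx3 by (field; lra). }
set (b := (x * a)%C).
assert (Hb : Cmod b = x) by (unfold b; rewrite Cmod_mult, Ha, Cmod_R, Rabs_pos_eq; lra).
assert (Hb0 : b <> 0) by (apply Cmod_gt_0; lra).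
set (y := monomial (/ b ^ D) D).
set (q := plateau y D).
set (h := padd (pshift b P) (pscale (- (1)) G)).
assert (Ny : pnorm y = / x ^ D).
{ unfold y; rewrite pnorm_monomial, Cmod_inv, Cmod_pow, Hb; [easy|now apply Cpow_nz]. }
assert (xD : 1 <= x ^ m) by (apply pow_R1_Rle; lra).
assert (xD' : 1 <= x ^ D) by (apply pow_R1_Rle; lra).
exists n, (pmul h q); split; [|split].
- assert (H1 := length_pmul h q); unfold h in H1 at 2; rewrite length_padd, length_pscale in H1.
  assert (H2 := length_pshift b P).
  assert (H3 := length_plateau y D).
  unfold y in H3 at 3; rewrite length_monomial in H3; fold q in H3.
  specialize (H3 ltac:(unfold y, monomial; now destruct (repeat (RtoC 0) D))).
  lia.
- eapply Rle_trans; [apply pnorm_pmul|].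
  assert (Hq : pnorm q <= 2 ^ D * / x ^ D).
  { rewrite <- Ny; eapply Rle_trans; [apply pnorm_plateau|].
    - rewrite Ny, <- Rinv_1; apply Rinv_le_contravar; lra.
    - apply Rmult_le_compat_r; [apply pnorm_ge_0|lra]. }
  assert (Hh : pnorm h <= (pnorm P * 2 ^ D + pnorm G) * x ^ m).
  { unfold h; eapply Rle_trans; [apply pnorm_padd|].
    rewrite pnorm_pscale, Cmod_m1.
    assert (H1 := pnorm_pshift b P); rewrite Hb in H1.
    assert (H2 : (x + 1) ^ length P <= 2 ^ D * x ^ m).
    { apply Rle_trans with ((2 * x) ^ length P); [apply pow_incr; lra|].
      rewrite Rpow_mult_distr; apply Rmult_le_compat; try (apply pow_le; lra);
        apply Rle_pow; unfold D, m; lra || lia. }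
    nra. }
  eapply Rle_trans; [apply Rmult_le_compat; [apply pnorm_ge_0|apply pnorm_ge_0|exact Hh|exact Hq]|].
  eapply Rle_trans; [|exact HC1]; right; unfold C1.
  rewrite <- (pow_div_succ x m Hx); unfold D; ring.
- intros w Hw; fold x b; set (z := (w + b)%C).
  assert (E : (peval G z + peval (pmul h q) z - peval P w
    = (peval G z - peval P w) * (1 - peval q z))%C).
  { rewrite peval_pmul; unfold h; rewrite peval_padd, peval_pshift, peval_pscale.
    replace (z - b)%C with w by (unfold z; ring); ring. }
  rewrite E; unfold q; rewrite peval_plateau; unfold y; rewrite peval_monomial.
  set (u := (w / b)%C).
  replace (/ b ^ D * z ^ D)%C with ((1 + u) ^ D)%C.
  2:{ rewrite <- Cpow_inv, <- Cpow_mult_l by easy; f_equal; unfold u, z; field; easy. }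
  assert (Hu : Cmod u <= R0 * / x).
  { unfold u; rewrite Cmod_div, Hb by easy.
    apply Rmult_le_compat_r; [apply Rlt_le, Rinv_0_lt_compat|]; easy. }
  assert (Hx' : 0 < / x) by now apply Rinv_0_lt_compat.
  assert (Hu1 : Cmod u <= 1).
  { eapply Rle_trans; [exact Hu|]; rewrite <- (Rinv_r x) by lra.
    apply Rmult_le_compat_r; lra. }
  assert (Hz : Cmod z <= R0 + x).
  { unfold z; eapply Rle_trans; [apply Cmod_triangle|]; rewrite Hb; lra. }
  assert (H3 : forall k, (k <= m)%nat -> (R0 + x + 1) ^ k <= 3 ^ m * x ^ m).
  { intros k Hk; rewrite <- Rpow_mult_distr.
    apply Rle_trans with ((3 * x) ^ k); [apply pow_incr; lra|].
    apply Rle_pow; [lra|easy]. }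
  assert (HG : Cmod (peval G z) <= pnorm G * (3 ^ m * x ^ m)).
  { eapply Rle_trans; [apply (peval_bound _ _ _ Hz)|].
    apply Rmult_le_compat_l; [easy|]; apply H3; unfold m; lia. }
  assert (HP : Cmod (peval P w) <= pnorm P * (3 ^ m * x ^ m)).
  { eapply Rle_trans; [apply (peval_bound _ _ (R0 + x)); lra|].
    apply Rmult_le_compat_l; [easy|]; apply H3; unfold m; lia. }
  assert (HGP : Cmod (peval G z - peval P w)%C <= (pnorm G + pnorm P) * (3 ^ m * x ^ m)).
  { unfold Cminus; eapply Rle_trans; [apply Cmod_triangle|]; rewrite Cmod_opp; lra. }
  assert (Hpw : Cmod (1 - (1 + u) ^ D)%C ^ D <= (R0 * 2 ^ D) ^ D * / x ^ D).
  { rewrite <- pow_inv, <- Rpow_mult_distr.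
    apply pow_incr; split; [apply Cmod_ge_0|].
    eapply Rle_trans; [now apply Cmod_pow_near_1|].
    replace (R0 * 2 ^ D * / x) with (R0 * / x * 2 ^ D) by ring.
    apply Rmult_le_compat_r; lra. }
  rewrite Cmod_mult, Cmod_pow.
  eapply Rle_trans; [apply Rmult_le_compat;
    [apply Cmod_ge_0|apply pow_le, Cmod_ge_0|exact HGP|exact Hpw]|].
  eapply Rle_trans; [|exact HC2]; right; unfold C2.
  rewrite <- (pow_div_succ x m Hx); unfold D; ring.
Qed.

(** * A countable dense family of polynomials *)

Definition rational_seq (n : nat) : R :=
  let (a, b) := Cantor.of_nat n in
  let (p, m) := Cantor.of_nat a in (INR p - INR m) / INR (S b).

Lemma rational_seq_dense (x eps : R) : 0 < eps ->
  exists n, Rabs (rational_seq n - x) < eps.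
Proof.
intros He.
destruct (exists_large_nat (/ eps)) as [b Hb].
assert (HS : 0 < INR (S b)) by (apply lt_0_INR; lia).
set (k := up (x * INR (S b))).
assert (Hk := archimed (x * INR (S b))); fold k in Hk.
assert (E : IZR k = INR (Z.to_nat k) - INR (Z.to_nat (- k))).
{ rewrite !INR_IZR_INZ, <- minus_IZR; f_equal; lia. }
exists (Cantor.to_nat (Cantor.to_nat (Z.to_nat k, Z.to_nat (- k)), b)).
unfold rational_seq; rewrite !Cantor.cancel_of_to, <- E.
assert (H1 : 1 < eps * INR (S b)).
{ apply Rmult_le_compat_l with (r := eps) in Hb; [|lra].
  rewrite Rinv_r in Hb by lra; rewrite S_INR; lra. }
apply Rabs_def1; apply Rmult_lt_reg_r with (INR (S b)); try easy;
  unfold Rdiv; rewrite Rmult_minus_distr_r, Rmult_assoc, Rinv_l by lra; lra.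
Qed.

Definition complex_rational_seq (n : nat) : C :=
  let (a, b) := Cantor.of_nat n in (rational_seq a, rational_seq b).

Lemma complex_rational_seq_dense (z : C) (eps : R) : 0 < eps ->
  exists n, Cmod (z - complex_rational_seq n)%C <= eps.
Proof.
intros He.
destruct (rational_seq_dense (Re z) (eps / 2)) as [a Ha]; [lra|].
destruct (rational_seq_dense (Im z) (eps / 2)) as [b Hb]; [lra|].
exists (Cantor.to_nat (a, b)).
unfold complex_rational_seq; rewrite Cantor.cancel_of_to, Cmod_minus_sym.
eapply Rle_trans; [apply Cmod_Re_Im|].
change (Rabs (rational_seq a - Re z) + Rabs (rational_seq b - Im z) <= eps); lra.
Qed.

Fixpoint decode_list (len n : nat) : list nat :=
  match len with
  | O => nil
  | S len => let (a, b) := Cantor.of_nat n in a :: decode_list len b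
  end.

Lemma decode_list_surj (s : list nat) : exists n, decode_list (length s) n = s.
Proof.
induction s as [|a s [b IH]]; [now exists O|].
exists (Cantor.to_nat (a, b)); cbn [decode_list length].
now rewrite Cantor.cancel_of_to, IH.
Qed.

Definition poly_seq (j : nat) : list C :=
  let (len, code) := Cantor.of_nat j in
  map complex_rational_seq (decode_list len code).

Lemma poly_seq_dense (P : list C) (r eps : R) : 0 <= r -> 0 < eps ->
  exists j, forall z, Cmod z <= r ->
    Cmod (peval P z - peval (poly_seq j) z)%C <= eps.
Proof.
intros Hr; revert eps.
enough (H : forall eps, 0 < eps -> exists s, forall z, Cmod z <= r ->
  Cmod (peval P z - peval (map complex_rational_seq s) z)%C <= eps).
{ intros eps He; destruct (H eps He) as [s Hs], (decode_list_surj s) as [n Hn].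
  exists (Cantor.to_nat (length s, n)).
  unfold poly_seq; now rewrite Cantor.cancel_of_to, Hn. }
induction P as [|c P IH]; intros eps He.
- exists nil; intros z _; cbn.
  replace (RtoC 0 - RtoC 0)%C with (RtoC 0) by ring; rewrite Cmod_0; lra.
- destruct (complex_rational_seq_dense c (eps / 2)) as [n Hn]; [lra|].
  destruct (IH (eps / (2 * (r + 1)))) as [s Hs]; [apply Rdiv_lt_0_compat; lra|].
  exists (n :: s); intros z Hz; cbn.
  set (Q := peval (map complex_rational_seq s) z) in *.
  replace (c + z * peval P z - (complex_rational_seq n + z * Q))%C
    with ((c - complex_rational_seq n) + z * (peval P z - Q))%C by ring.
  eapply Rle_trans; [apply Cmod_triangle|]; rewrite Cmod_mult.
  assert (H1 : Cmod z * Cmod (peval P z - Q)%C <= r * (eps / (2 * (r + 1)))).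
  { apply Rmult_le_compat; auto using Cmod_ge_0; now apply Hs. }
  assert (H2 : eps / 2 = r * (eps / (2 * (r + 1))) + eps / (2 * (r + 1))) by (field; lra).
  assert (0 < eps / (2 * (r + 1))) by (apply Rdiv_lt_0_compat; lra).
  lra.
Qed.

(** * The universal function as a sum of corrections *)

Lemma pseries_term_le (A : nat -> R) (r l : R) (n : nat) :
  (forall i, 0 < A i) -> 0 <= r -> is_pseries A r l -> A n * r ^ n <= l.
Proof.
intros HA Hr H.
set (a := fun k => scal (pow_n r k) (A k)).
assert (Ha : forall k, a k = A k * r ^ k).
{ intros k; unfold a; rewrite pow_n_pow; apply Rmult_comm. }
assert (Ha0 : forall k, 0 <= a k).
{ intros k; rewrite Ha; apply Rmult_le_pos; [apply Rlt_le, HA|now apply pow_le]. }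
assert (Hle : sum_n a n <= l).
{ apply (is_lim_seq_incr_compare (sum_n a) l H).
  intros k; rewrite sum_Sn; specialize (Ha0 (S k)).
  change (sum_n a k <= sum_n a k + a (S k)); lra. }
rewrite <- Ha; eapply Rle_trans; [|exact Hle].
assert (Hs : forall k, 0 <= sum_n a k).
{ intros k; rewrite sum_n_Reals; apply cond_pos_sum, Ha0. }
destruct n as [|n]; [rewrite sum_O; lra|].
rewrite sum_Sn; specialize (Hs n).
change (a (S n) <= sum_n a n + a (S n)); lra.
Qed.

Lemma peval_growth (l : list C) (z : C) (d : nat) : (length l <= d)%nat ->
  Cmod (peval l z) <= pnorm l * (1 + Cmod z ^ d).
Proof.
intros Hd; assert (Z := Cmod_ge_0 z).
apply Rle_trans with (pnorm l * Rmax 1 (Cmod z) ^ length l).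
{ clear Hd; assert (M1 := Rmax_l 1 (Cmod z)); assert (M2 := Rmax_r 1 (Cmod z)).
  induction l as [|c l IH]; cbn; [rewrite Cmod_0; lra|].
  eapply Rle_trans; [apply Cmod_triangle|]; rewrite Cmod_mult.
  set (M := Rmax 1 (Cmod z)) in *.
  assert (HP : 1 <= M ^ length l) by now apply pow_R1_Rle.
  assert (HC := Cmod_ge_0 c); assert (HN := pnorm_ge_0 l).
  assert (Cmod z * Cmod (peval l z) <= M * (pnorm l * M ^ length l))
    by (apply Rmult_le_compat; auto using Cmod_ge_0).
  assert (1 <= M * M ^ length l) by nra.
  nra. }
apply Rmult_le_compat_l; [apply pnorm_ge_0|].
assert (HZ : 0 <= Cmod z ^ d) by now apply pow_le.
unfold Rmax; destruct (Rle_dec 1 (Cmod z)) as [H|H]; [|rewrite pow1; lra].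
assert (Cmod z ^ length l <= Cmod z ^ d) by now apply Rle_pow.
lra.
Qed.

(** Smallness is asked for through [pnorm g * (INR rho + 1) ^ length g], which
    dominates the values, the derivative and the Taylor remainder of [g] on the
    disc of radius [rho] at the same time. *)
Definition good_correction (phi : R -> R) (a : C) (P G : list C) (k rho n : nat)
    (g : list C) : Prop :=
  (forall z, Cmod (peval g z) <= (/ 2) ^ S k * phi (Cmod z)) /\
  pnorm g * (INR rho + 1) ^ length g <= (/ 2) ^ S k /\
  (forall w, Cmod w <= INR (S k) ->
     Cmod (peval (padd G g) (w + INR n * a) - peval P w)%C <= (/ 2) ^ k).

(** A polynomial of norm [eta] and degree less than [d] is at most
    [eta (1 + |z|^d)], hence at most [eta (1/A 0 + 1/A d) phi], as the terms of
    the series of [phi] are positive. *)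
Lemma good_correction_exists (A : nat -> R) (phi : R -> R) (a : C) (P G : list C)
    (k rho : nat) :
  (forall i, 0 < A i) -> (forall r, 0 <= r -> is_pseries A r (phi r)) ->
  Cmod a = 1 -> exists ng, good_correction phi a P G k rho (fst ng) (snd ng).
Proof.
intros HA Hphi Ha.
destruct (polynomial_correction G P a (INR (S k)) Ha (pos_INR _)) as [d Hd].
set (e := (/ 2) ^ S k).
assert (He : 0 < e) by (apply pow_lt; lra).
set (c := / A O + / A d).
assert (Hc : 0 < c).
{ assert (H1 := Rinv_0_lt_compat _ (HA O)); assert (H2 := Rinv_0_lt_compat _ (HA d)).
  unfold c; lra. }
assert (Hrho : 0 < (INR rho + 1) ^ d) by (apply pow_lt; assert (H := pos_INR rho); lra).
destruct (Hd (Rmin (e / c) (e / (INR rho + 1) ^ d)) ((/ 2) ^ k)) as (n & g & Hl & Hg & Hw).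
{ apply Rmin_pos; now apply Rdiv_lt_0_compat. }
{ apply pow_lt; lra. }
assert (Hg1 := Rle_trans _ _ _ Hg (Rmin_l _ _)).
assert (Hg2 := Rle_trans _ _ _ Hg (Rmin_r _ _)).
exists (n, g); cbn [fst snd]; split; [|split].
- intros z; assert (Z := Cmod_ge_0 z).
  eapply Rle_trans; [exact (peval_growth g z d Hl)|].
  assert (H0 := pseries_term_le A _ _ O HA Z (Hphi _ Z)).
  assert (H1 := pseries_term_le A _ _ d HA Z (Hphi _ Z)).
  assert (Hs : 1 + Cmod z ^ d <= c * phi (Cmod z)).
  { unfold c; rewrite Rmult_plus_distr_r; apply Rplus_le_compat.
    - rewrite pow_O, Rmult_1_r in H0; apply Rmult_le_reg_l with (A O); [apply HA|].
      rewrite <- Rmult_assoc, Rinv_r; [lra|]; specialize (HA O); lra.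
    - apply Rmult_le_reg_l with (A d); [apply HA|].
      rewrite <- Rmult_assoc, Rinv_r; [lra|]; specialize (HA d); lra. }
  fold e; replace (e * phi (Cmod z)) with (e / c * (c * phi (Cmod z))) by (field; lra).
  apply Rmult_le_compat; [apply pnorm_ge_0| |exact Hg1|exact Hs].
  assert (0 <= Cmod z ^ d) by now apply pow_le.
  lra.
- fold e; replace e with (e / (INR rho + 1) ^ d * (INR rho + 1) ^ d) by (field; lra).
  assert (Hr := pos_INR rho).
  apply Rmult_le_compat; [apply pnorm_ge_0|apply pow_le; lra|easy|].
  apply Rle_pow; [lra|easy].
- intros w H; rewrite peval_padd; now apply Hw.
Qed.

(** Real and imaginary parts are found in nested intervals around the terms.  The
    predicate [ok] is there because the estimates for the partial sums at a point
    hold only once the discs have grown beyond that point; the conclusion is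
    wanted from the first such index on. *)
Lemma geometric_limit (u : nat -> C) (ok : nat -> Prop) :
  (forall k, ok k -> ok (S k)) -> (exists k, ok k) ->
  (forall k, ok k -> Cmod (u (S k) - u k)%C <= (/ 2) ^ S k) ->
  exists l, forall k, ok k -> Cmod (l - u k)%C <= 2 * (/ 2) ^ k.
Proof.
intros Hok [K HK] Hu.
assert (Hok' : forall k i, ok k -> ok (k + i)%nat).
{ intros k i Hk; induction i as [|i IH].
  - now rewrite Nat.add_0_r.
  - rewrite Nat.add_succ_r; now apply Hok. }
assert (Hpart : forall p : C -> R, (forall z w, p (z - w)%C = p z - p w) ->
  (forall z, Rabs (p z) <= Cmod z) ->
  exists t, forall i, Rabs (t - p (u (K + i)%nat)) <= (/ 2) ^ (K + i)).
{ intros p Hp Hp'.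
  destruct (nested_intervals (fun i => p (u (K + i)%nat) - (/ 2) ^ (K + i))
     (fun i => p (u (K + i)%nat) + (/ 2) ^ (K + i))) as [t Ht].
  - intros i; assert (H := Hu _ (Hok' K i HK)).
    assert (H' := Hp' (u (S (K + i)) - u (K + i)%nat)%C).
    rewrite Hp in H'; apply Rle_trans with (2 := H) in H'; apply Rabs_le_between in H'.
    rewrite Nat.add_succ_r; cbn [pow] in *; lra.
  - intros i; assert (H := Hu _ (Hok' K i HK)).
    assert (H' := Hp' (u (S (K + i)) - u (K + i)%nat)%C).
    rewrite Hp in H'; apply Rle_trans with (2 := H) in H'; apply Rabs_le_between in H'.
    rewrite Nat.add_succ_r; cbn [pow] in *; lra.
  - intros i; assert (H : 0 < (/ 2) ^ (K + i)) by (apply pow_lt; lra); lra.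
  - exists t; intros i; apply Rabs_le; specialize (Ht i); lra. }
destruct (Hpart Re) as [x Hx]; [easy|apply re_le_Cmod|].
destruct (Hpart Im) as [y Hy]; [easy|apply Rabs_Im_le|].
assert (Htel : forall k i, ok k ->
  Cmod (u (k + i)%nat - u k)%C <= (/ 2) ^ k - (/ 2) ^ (k + i)).
{ intros k i Hk; induction i as [|i IH].
  - rewrite Nat.add_0_r; replace (u k - u k)%C with (RtoC 0) by ring; rewrite Cmod_0; lra.
  - rewrite Nat.add_succ_r.
    eapply Rle_trans; [apply (Cmod_minus_triangle _ (u (k + i)%nat))|].
    assert (H := Hu _ (Hok' k i Hk)); cbn [pow] in *; lra. }
exists (x, y); intros k Hk.
eapply Rle_trans; [apply (Cmod_minus_triangle _ (u (K + k)%nat))|].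
assert (H1 : Cmod ((x, y) - u (K + k)%nat)%C <= 2 * (/ 2) ^ (K + k)).
{ eapply Rle_trans; [apply Cmod_Re_Im|].
  specialize (Hx k); specialize (Hy k).
  change (Rabs (x - Re (u (K + k)%nat)) + Rabs (y - Im (u (K + k)%nat))
    <= 2 * (/ 2) ^ (K + k)); lra. }
assert (H2 := Htel k K Hk); rewrite (Nat.add_comm k K) in H2.
assert (H3 : (/ 2) ^ (K + k) <= (/ 2) ^ k).
{ rewrite pow_add; assert (0 < (/ 2) ^ k) by (apply pow_lt; lra).
  assert ((/ 2) ^ K <= 1 ^ K) by (apply pow_incr; lra).
  rewrite pow1 in *; nra. }
lra.
Qed.

Lemma le_of_geometric_error (x y c : R) (K : nat) :
  (forall k, (K <= k)%nat -> x <= y + c * (/ 2) ^ k) -> x <= y.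
Proof.
intros H; apply Rnot_lt_le; intros Hlt.
assert (Hc : 0 < Rabs c + 1) by (assert (H0 := Rabs_pos c); lra).
destruct (pow_lt_1_zero (/ 2) ltac:(rewrite Rabs_right; lra)
  ((x - y) / (Rabs c + 1)) ltac:(apply Rdiv_lt_0_compat; lra)) as [N HN].
specialize (HN (K + N)%nat ltac:(lia)); specialize (H (K + N)%nat ltac:(lia)).
set (p := (/ 2) ^ (K + N)) in *.
assert (Hp : 0 < p) by (apply pow_lt; lra).
rewrite Rabs_pos_eq in HN by lra.
apply (Rmult_lt_compat_l _ _ _ Hc) in HN.
replace ((Rabs c + 1) * ((x - y) / (Rabs c + 1))) with (x - y) in HN by (field; lra).
assert (Hcc := Rle_abs c); nra.
Qed.

Lemma ex_derive_of_quadratic (F : C -> C) (z l : C) (B : R) :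
  (forall w, Cmod (w - z)%C <= 1 ->
    Cmod (F w - F z - (w - z) * l)%C <= B * Cmod (w - z)%C ^ 2) ->
  @ex_derive C_AbsRing C_NormedModule F z.
Proof.
intros H; exists l; split; [apply is_linear_scal_l|].
intros x Hx eps.
assert (x = z) as -> by (symmetry;
  now apply (is_filter_lim_locally_unique (V := AbsRing_NormedModule C_AbsRing))).
assert (HB : 0 < Rabs B + 1) by (assert (H0 := Rabs_pos B); lra).
assert (He := cond_pos eps).
assert (Hd : 0 < Rmin 1 (eps / (Rabs B + 1)))
  by (apply Rmin_pos; [lra|now apply Rdiv_lt_0_compat]).
exists (mkposreal _ Hd); intros w Hw.
change (Cmod (w - z)%C < Rmin 1 (eps / (Rabs B + 1))) in Hw.
change (Cmod (F w - F z - (w - z) * l)%C <= eps * Cmod (w - z)%C).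
assert (H1 := Rlt_le_trans _ _ _ Hw (Rmin_l _ _)).
assert (H2 := Rlt_le_trans _ _ _ Hw (Rmin_r _ _)).
apply (Rmult_lt_compat_l _ _ _ HB) in H2.
replace ((Rabs B + 1) * (eps / (Rabs B + 1))) with (pos eps) in H2 by (field; lra).
eapply Rle_trans; [apply H; lra|].
assert (H3 := Cmod_ge_0 (w - z)%C); assert (H4 := Rle_abs B).
replace (B * Cmod (w - z)%C ^ 2) with (B * Cmod (w - z)%C * Cmod (w - z)%C) by ring.
apply Rmult_le_compat_r; [easy|nra].
Qed.

(** The partial sum and the radius that must be protected.  The radius absorbs
    the new point [fst ng] and the disc of radius [S k] around it. *)
Definition stage (next : nat -> list C * nat -> nat * list C) : nat -> list C * nat :=
  fix st k := match k with
  | O => (nil, O)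
  | S k =>
      let ng := next k (st k) in
      (padd (fst (st k)) (snd ng), snd (st k) + fst ng + S k)%nat
  end.

(** The limit is differentiable without any appeal to Weierstrass' theorem: the
    second order Taylor remainders of the corrections are summable, so the
    remainder of the limit is quadratic with the limit of the derivatives as
    its linear coefficient. *)
Lemma approximation_scheme (A : nat -> R) (phi : R -> R) (theta : nat -> C)
    (P : nat -> list C) :
  (forall i, 0 < A i) -> (forall r, 0 <= r -> is_pseries A r (phi r)) ->
  (forall k, Cmod (theta k) = 1) ->
  exists F, entire F /\ (forall z, Cmod (F z) <= phi (Cmod z)) /\
    forall k, exists n : nat, forall w, Cmod w <= INR (S k) ->
      Cmod (F (w + INR n * theta k) - peval (P k) w)%C <= 2 * (/ 2) ^ k.
Proof.
intros HA Hphi Htheta.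
destruct (functional_choice (fun kst ng => good_correction phi (theta (fst kst))
   (P (fst kst)) (fst (snd kst)) (fst kst) (snd (snd kst)) (fst ng) (snd ng)))
  as [nx Hnx].
{ intros [k [G rho]]; now apply (good_correction_exists A). }
set (next := fun k st => nx (k, st)).
set (G := fun k => fst (stage next k)); set (rho := fun k => snd (stage next k)).
set (n := fun k => fst (next k (stage next k))).
set (g := fun k => snd (next k (stage next k))).
assert (HG : forall k, G (S k) = padd (G k) (g k)) by easy.
assert (Hrho : forall k, rho (S k) = (rho k + n k + S k)%nat) by easy.
assert (Hgood : forall k, good_correction phi (theta k) (P k) (G k) k (rho k) (n k) (g k))
  by (intros k; exact (Hnx (k, stage next k))).
assert (Hk : forall k, INR k <= INR (rho k)).
{ intros [|k]; apply le_INR; [unfold rho; cbn; lia|rewrite Hrho; lia]. }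
assert (Hmono : forall k, INR (rho k) <= INR (rho (S k)))
  by (intros k; apply le_INR; rewrite Hrho; lia).
clearbody n g; clearbody rho.
assert (G0 : G O = nil) by easy.
clearbody G; clear nx Hnx next.
assert (Hp : forall k, 0 < (/ 2) ^ k) by (intros; apply pow_lt; lra).
(* [E] will be [peval] and then [pderiv]. *)
assert (Hlim : forall E : list C -> C -> C,
  (forall l m z, E (padd l m) z = (E l z + E m z)%C) ->
  (forall l z r, Cmod z <= r -> Cmod (E l z) <= pnorm l * (r + 1) ^ length l) ->
  forall z, exists l, forall k, Cmod z <= INR (rho k) ->
    Cmod (l - E (G k) z)%C <= 2 * (/ 2) ^ k).
{ intros E HE HB z.
  apply (geometric_limit (fun k => E (G k) z) (fun k => Cmod z <= INR (rho k))).
  - intros k H; specialize (Hmono k); lra.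
  - destruct (exists_large_nat (Cmod z)) as [k H]; exists k; specialize (Hk k); lra.
  - intros k H; rewrite HG, HE.
    replace (E (G k) z + E (g k) z - E (G k) z)%C with (E (g k) z) by ring.
    destruct (Hgood k) as (_ & H2 & _).
    eapply Rle_trans; [exact (HB _ _ _ H)|exact H2]. }
destruct (functional_choice _ (Hlim peval peval_padd peval_bound)) as [F HF].
assert (HD := Hlim pderiv pderiv_padd pderiv_bound).
exists F; split; [|split].
- intros z; destruct (HD z) as [l Hl].
  destruct (exists_large_nat (Cmod z + 1)) as [K HK].
  set (B := pnorm (G K) * (INR K + 1) ^ length (G K)).
  apply ex_derive_of_quadratic with l (B + 1); intros w Hw.
  assert (HwK : Cmod w <= INR K).
  { assert (H := Cmod_le_add w z); lra. }
  assert (HzK : Cmod z <= INR K) by lra.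
  assert (HKi : forall i, INR K <= INR (rho (K + i)%nat)).
  { intros i; eapply Rle_trans; [|apply Hk]; apply le_INR; lia. }
  set (rem := fun l => (peval l w - peval l z - (w - z) * pderiv l z)%C).
  assert (Hrem : forall i, Cmod (rem (G (K + i)%nat))
    <= (B + 1 - (/ 2) ^ (K + i)) * Cmod (w - z)%C ^ 2).
  { assert (H2 := pow2_ge_0 (Cmod (w - z)%C)).
    induction i as [|i IH].
    - rewrite Nat.add_0_r.
      eapply Rle_trans; [apply (premainder_bound _ _ _ _ HzK HwK)|].
      apply Rmult_le_compat_r; [easy|].
      assert (H := pow_incr (/ 2) 1 K ltac:(lra)); rewrite pow1 in H; fold B; lra.
    - rewrite Nat.add_succ_r, HG.
      replace (rem (padd (G (K + i)%nat) (g (K + i)%nat)))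
        with (rem (G (K + i)%nat) + rem (g (K + i)%nat))%C
        by (unfold rem; rewrite !peval_padd, pderiv_padd; ring).
      eapply Rle_trans; [apply Cmod_triangle|].
      destruct (Hgood (K + i)%nat) as (_ & H3 & _); specialize (HKi i).
      assert (H4 := premainder_bound (g (K + i)%nat) z w (INR (rho (K + i)%nat))
        ltac:(lra) ltac:(lra)).
      fold (rem (g (K + i)%nat)) in H4.
      apply (Rmult_le_compat_r _ _ _ H2) in H3.
      cbn [pow] in *; lra. }
  apply le_of_geometric_error with (2 + 2 + 2) K; intros k HkK.
  specialize (Hrem (k - K)%nat); specialize (HKi (k - K)%nat).
  replace (K + (k - K))%nat with k in * by lia.
  assert (E1 := HF w k ltac:(lra)); assert (E2 := HF z k ltac:(lra)).
  assert (E3 := Hl k ltac:(lra)).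
  replace (F w - F z - (w - z) * l)%C
    with (rem (G k) + (F w - peval (G k) w) - (F z - peval (G k) z)
      - (w - z) * (l - pderiv (G k) z))%C by (unfold rem; ring).
  unfold Cminus at 1 2.
  eapply Rle_trans; [apply Cmod_triangle|]; rewrite Cmod_opp, Cmod_mult.
  eapply Rle_trans; [apply Rplus_le_compat_r, Cmod_triangle|]; rewrite Cmod_opp.
  eapply Rle_trans; [apply Rplus_le_compat_r, Rplus_le_compat_r, Cmod_triangle|].
  assert (E4 : Cmod (w - z)%C * Cmod (l - pderiv (G k) z)%C <= 1 * (2 * (/ 2) ^ k))
    by (apply Rmult_le_compat; auto using Cmod_ge_0).
  assert (E5 := pow2_ge_0 (Cmod (w - z)%C)); specialize (Hp k).
  assert (0 <= (/ 2) ^ k * Cmod (w - z)%C ^ 2) by (apply Rmult_le_pos; lra).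
  lra.
- intros z.
  assert (Hphi0 : 0 <= phi (Cmod z)).
  { eapply Rle_trans; [|apply (pseries_term_le A (Cmod z) _ O HA)];
      [|apply Cmod_ge_0|apply Hphi, Cmod_ge_0].
    rewrite pow_O, Rmult_1_r; apply Rlt_le, HA. }
  assert (HGk : forall k, Cmod (peval (G k) z) <= (1 - (/ 2) ^ k) * phi (Cmod z)).
  { induction k as [|k IH]; [rewrite G0; cbn; rewrite Cmod_0; lra|].
    rewrite HG, peval_padd; eapply Rle_trans; [apply Cmod_triangle|].
    destruct (Hgood k) as (H1 & _ & _); specialize (H1 z); cbn [pow] in *; lra. }
  destruct (exists_large_nat (Cmod z)) as [K HK].
  apply le_of_geometric_error with 2 K; intros k HkK.
  assert (H1 : Cmod z <= INR (rho k)).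
  { eapply Rle_trans; [exact HK|]; eapply Rle_trans; [|apply Hk]; now apply le_INR. }
  assert (H2 := HF z k H1); assert (H3 := Cmod_le_add (F z) (peval (G k) z)).
  specialize (HGk k); specialize (Hp k); nra.
- intros k; exists (n k); intros w Hw.
  destruct (Hgood k) as (_ & _ & H3); specialize (H3 w Hw); rewrite <- HG in H3.
  eapply Rle_trans; [apply (Cmod_minus_triangle _ (peval (G (S k)) (w + INR (n k) * theta k)))|].
  assert (H4 : Cmod (w + INR (n k) * theta k)%C <= INR (rho (S k))).
  { eapply Rle_trans; [apply Cmod_triangle|].
    rewrite Cmod_mult, Htheta, Cmod_R, Rabs_pos_eq by apply pos_INR.
    apply Rle_trans with (INR (n k + S k)).
    - rewrite plus_INR; lra.
    - apply le_INR; rewrite Hrho; lia. }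
  assert (H5 := HF _ _ H4); cbn [pow] in H5; lra.
Qed.

(** * Hypercyclic directions form a residual set *)

Lemma baire_interval (U : nat -> R -> Prop) (a b : R) : a < b ->
  (forall i x y, a <= x -> x < y -> y <= b -> exists x' y',
     x <= x' /\ x' < y' /\ y' <= y /\ forall t, x' <= t <= y' -> U i t) ->
  exists t, a <= t <= b /\ forall i, U i t.
Proof.
intros Hab H.
destruct (functional_choice (fun (ixy : nat * (R * R)) (xy' : R * R) =>
    let (i, xy) := ixy in
    a <= fst xy -> fst xy < snd xy -> snd xy <= b ->
    fst xy <= fst xy' /\ fst xy' < snd xy' /\ snd xy' <= snd xy /\
    forall t, fst xy' <= t <= snd xy' -> U i t)) as [nx Hnx].
{ intros [i [x y]]; cbn [fst snd].
  destruct (classic (a <= x /\ x < y /\ y <= b)) as [(H1 & H2 & H3)|H1].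
  - destruct (H i x y H1 H2 H3) as (x' & y' & H'); now exists (x', y').
  - exists (x, y); tauto. }
set (I := fix I n := match n with O => (a, b) | S n => nx (n, I n) end).
assert (HI : forall n, a <= fst (I n) /\ fst (I n) < snd (I n) /\ snd (I n) <= b).
{ induction n as [|n (H1 & H2 & H3)]; [cbn; lra|].
  destruct (Hnx (n, I n) H1 H2 H3) as (H4 & H5 & H6 & _).
  change (I (S n)) with (nx (n, I n)); lra. }
assert (HI' : forall n, fst (I n) <= fst (I (S n)) /\ snd (I (S n)) <= snd (I n) /\
  forall t, fst (I (S n)) <= t <= snd (I (S n)) -> U n t).
{ intros n; destruct (HI n) as (H1 & H2 & H3).
  destruct (Hnx (n, I n) H1 H2 H3) as (H4 & H5 & H6 & H7); auto. }
destruct (nested_intervals (fun n => fst (I n)) (fun n => snd (I n))) as [t Ht].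
- intros n; apply HI'.
- intros n; apply HI'.
- intros n; apply Rlt_le, HI.
- exists t; split; [exact (Ht O)|].
  intros i; apply (HI' i), Ht.
Qed.

Definition approximates (F : C -> C) (t : R) (j M : nat) : Prop :=
  exists n : nat, forall w, Cmod w <= INR M ->
    Cmod (F (w + INR n * cis t) - peval (poly_seq j) w)%C <= 3 * (/ 2) ^ M.

Lemma half_pow_le (k m : nat) : (k <= m)%nat -> (/ 2) ^ m <= (/ 2) ^ k.
Proof.
intros H; replace m with (k + (m - k))%nat by lia; rewrite pow_add.
assert (H1 := pow_lt (/ 2) k ltac:(lra)).
assert (H2 := pow_incr (/ 2) 1 (m - k) ltac:(lra)); rewrite pow1 in H2; nra.
Qed.

(** The precision [M] is part of the code of a task only to have each polynomial
    and direction treated at arbitrarily late stages: the index of the task is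
    at least [M]. *)
Lemma exists_approximating_function (A : nat -> R) (phi : R -> R) :
  (forall i, 0 < A i) -> (forall r, 0 <= r -> is_pseries A r (phi r)) ->
  exists F, entire F /\ (forall z, Cmod (F z) <= phi (Cmod z)) /\
    forall j c M, exists n : nat, forall w, Cmod w <= INR M + 1 ->
      Cmod (F (w + INR n * cis (rational_seq c)) - peval (poly_seq j) w)%C
      <= 2 * (/ 2) ^ M.
Proof.
intros HA Hphi.
destruct (approximation_scheme A phi
  (fun k => let (j, cM) := Cantor.of_nat k in
            let (c, M) := Cantor.of_nat cM in cis (rational_seq c))
  (fun k => let (j, cM) := Cantor.of_nat k in poly_seq j) HA Hphi) as (F & HF & Hb & Hn).
{ intros k; destruct (Cantor.of_nat k) as [j cM], (Cantor.of_nat cM) as [c M].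
  apply Cmod_cis. }
exists F; split; [easy|split; [easy|]]; intros j c M.
set (k := Cantor.to_nat (j, Cantor.to_nat (c, M))).
destruct (Hn k) as [n H]; unfold k in H at 2 3; rewrite !Cantor.cancel_of_to in H.
assert (Hk : (M <= k)%nat).
{ assert (H1 := Cantor.to_nat_non_decreasing j (Cantor.to_nat (c, M))).
  assert (H2 := Cantor.to_nat_non_decreasing c M); unfold k; lia. }
exists n; intros w Hw.
eapply Rle_trans; [apply H|].
- rewrite S_INR; apply le_INR in Hk; lra.
- assert (H1 := half_pow_le M k Hk); lra.
Qed.

(** Around a rational angle [s] treated by the construction, a nearby angle [t]
    moves the point [n cis s] by less than [e], which only shifts the argument of
    the polynomial [P]; this is why the hypothesis covers a disc larger by [1]. *)
Lemma approximates_open_dense (F : C -> C) (j M : nat) (x y : R) :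
  (forall c, exists n : nat, forall w, Cmod w <= INR M + 1 ->
     Cmod (F (w + INR n * cis (rational_seq c)) - peval (poly_seq j) w)%C
     <= 2 * (/ 2) ^ M) ->
  x < y -> exists x' y', x <= x' /\ x' < y' /\ y' <= y /\
    forall t, x' <= t <= y' -> approximates F t j M.
Proof.
intros HF Hxy.
destruct (rational_seq_dense ((x + y) / 2) ((y - x) / 2)) as [c Hc]; [lra|].
destruct (HF c) as [n Hn]; set (s := rational_seq c) in *.
apply Rabs_def2 in Hc.
set (P := poly_seq j) in *.
set (L := pnorm P * (INR M + 1 + 1) ^ length P).
assert (HM := pos_INR M); assert (Hn0 := pos_INR n).
assert (HL : 0 <= L).
{ apply Rmult_le_pos; [apply pnorm_ge_0|apply pow_le; lra]. }
assert (Hp : 0 < (/ 2) ^ M) by (apply pow_lt; lra).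
set (e := Rmin 1 ((/ 2) ^ M / (L + 1))).
assert (He : 0 < e) by (apply Rmin_pos; [lra|apply Rdiv_lt_0_compat; lra]).
assert (He1 : e <= 1) by apply Rmin_l.
assert (He2 : L * e <= (/ 2) ^ M).
{ assert (H1 : e <= (/ 2) ^ M / (L + 1)) by apply Rmin_r.
  apply (Rmult_le_compat_l (L + 1)) in H1; [|lra].
  replace ((L + 1) * ((/ 2) ^ M / (L + 1))) with ((/ 2) ^ M) in H1 by (field; lra); lra. }
set (d := e / (2 * (INR n + 1))).
assert (Hd : 0 < d) by (apply Rdiv_lt_0_compat; lra).
assert (Hnd : INR n * (2 * d) <= e).
{ replace e with ((INR n + 1) * (2 * d)) at 1 by (unfold d; field; lra); nra. }
exists (Rmax x (s - d)), (Rmin y (s + d)).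
split; [apply Rmax_l|]; split; [|split; [apply Rmin_l|]].
{ apply Rmax_lub_lt; apply Rmin_glb_lt; lra. }
intros t [Ht1 Ht2].
assert (Ht : Rabs (t - s) <= d).
{ apply Rabs_le; assert (H1 := Rmax_r x (s - d)); assert (H2 := Rmin_r y (s + d)); lra. }
exists n; intros w Hw; fold P.
set (u := (INR n * (cis t - cis s))%C).
assert (Hu : Cmod u <= e).
{ unfold u; rewrite Cmod_mult, Cmod_R, Rabs_pos_eq by easy.
  eapply Rle_trans; [|exact Hnd]; apply Rmult_le_compat_l; [easy|].
  eapply Rle_trans; [apply cis_Lipschitz|]; lra. }
assert (Hwu : Cmod (w + u)%C <= INR M + 1).
{ eapply Rle_trans; [apply Cmod_triangle|]; lra. }
replace (w + INR n * cis t)%C with (w + u + INR n * cis s)%C by (unfold u; ring).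
eapply Rle_trans; [apply (Cmod_minus_triangle _ (peval P (w + u)))|].
specialize (Hn (w + u)%C Hwu).
assert (H1 := peval_Lipschitz P w (w + u) (INR M + 1) ltac:(lra) Hwu); fold L in H1.
replace (w + u - w)%C with u in H1 by ring.
assert (H2 : L * Cmod u <= L * e) by now apply Rmult_le_compat_l.
lra.
Qed.

(** On [[0, PI]] the cosine is decreasing, so on one side of the
    midpoint it stays on one side of the abscissa of [v]. *)
Lemma cis_avoid (v : C) (x y : R) : 0 <= x -> x < y -> y <= PI ->
  exists x' y', x <= x' /\ x' < y' /\ y' <= y /\
    forall t, x' <= t <= y' -> cis t <> v.
Proof.
intros Hx Hxy Hy; set (m := (x + y) / 2).
destruct (Rle_or_lt (cos m) (Re v)) as [H|H].
- exists ((m + y) / 2), y; unfold m in *; repeat split; try lra.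
  intros t Ht E; rewrite <- E in H; cbn in H.
  assert (H1 := cos_decreasing_1 ((x + y) / 2) t); lra.
- exists x, m; unfold m in *; repeat split; try lra.
  intros t Ht E; rewrite <- E in H; cbn in H.
  destruct (proj2 Ht) as [H2| ->]; [|lra].
  assert (H1 := cos_decreasing_1 t ((x + y) / 2)); lra.
Qed.

Lemma iter_translate (a : C) (F : C -> C) (n : nat) (z : C) :
  Nat.iter n (translate a) F z = F (z + INR n * a)%C.
Proof.
revert z; induction n as [|n IH]; intros z.
- cbn; f_equal; ring.
- change (Nat.iter (S n) (translate a) F z)
    with (Nat.iter n (translate a) F (z + a)%C).
  rewrite IH, S_INR, RtoC_plus; f_equal; ring.
Qed.

Lemma compact_set_bounded (K : C -> Prop) : compact_set K ->
  exists M : nat, forall z, K z -> Cmod z <= INR M.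
Proof.
intros HK.
destruct (HK nat (fun n z => Rabs (Re z) < INR n /\ Rabs (Im z) < INR n)) as [l Hl].
- intros n z [H1 H2].
  assert (Hd : 0 < Rmin (INR n - Rabs (Re z)) (INR n - Rabs (Im z)))
    by (apply Rmin_pos; lra).
  exists (mkposreal _ Hd); intros w [Hw1 Hw2].
  change (Rabs (Re w - Re z) < Rmin (INR n - Rabs (Re z)) (INR n - Rabs (Im z))) in Hw1.
  change (Rabs (Im w - Im z) < Rmin (INR n - Rabs (Re z)) (INR n - Rabs (Im z))) in Hw2.
  assert (H3 := Rmin_l (INR n - Rabs (Re z)) (INR n - Rabs (Im z))).
  assert (H4 := Rmin_r (INR n - Rabs (Re z)) (INR n - Rabs (Im z))).
  assert (H5 := Rabs_triang (Re w - Re z) (Re z)).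
  assert (H6 := Rabs_triang (Im w - Im z) (Im z)).
  replace (Re w - Re z + Re z) with (Re w) in H5 by ring.
  replace (Im w - Im z + Im z) with (Im w) in H6 by ring.
  split; lra.
- intros z _; destruct (exists_large_nat (Cmod z + 1)) as [n Hn].
  exists n; assert (H1 := re_le_Cmod z); assert (H2 := Rabs_Im_le z); lra.
- exists (2 * list_max l)%nat; intros z Hz; destruct (Hl z Hz) as (j & Hj & H1 & H2).
  assert (H3 : (j <= list_max l)%nat).
  { assert (H := proj1 (list_max_le l (list_max l)) (Nat.le_refl _)).
    now apply (proj1 (Forall_forall _ _) H). }
  apply le_INR in H3; rewrite mult_INR; cbn [INR].
  assert (H4 := Cmod_Re_Im z); lra.
Qed.

Lemma approximates_translates (F : C -> C) (t : R) :
  (forall j M, approximates F t j M) ->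
  forall H r eps, entire H -> 0 < eps -> exists n : nat, forall z, Cmod z <= r ->
    Cmod (F (z + INR n * cis t) - H z)%C < eps.
Proof.
intros HF H r eps HH He.
destruct (exists_large_nat r) as [M0 HM0].
destruct (pow_lt_1_zero (/ 2) ltac:(rewrite Rabs_right; lra) (eps / 9) ltac:(lra))
  as [M1 HM1].
set (M := (M0 + M1)%nat); specialize (HM1 M ltac:(unfold M; lia)).
rewrite Rabs_pos_eq in HM1 by (apply pow_le; lra).
destruct (entire_polynomial_approx H (INR M) (eps / 4) HH) as [P HP]; [lra|].
destruct (poly_seq_dense P (INR M) (eps / 4)) as [j Hj]; [apply pos_INR|lra|].
destruct (HF j M) as [n Hn]; exists n; intros z Hz.
assert (HzM : Cmod z <= INR M).
{ unfold M; rewrite plus_INR; assert (H0 := pos_INR M1); lra. }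
specialize (HP z HzM); specialize (Hj z HzM); specialize (Hn z HzM).
assert (T1 := Cmod_minus_triangle (F (z + INR n * cis t)%C) (peval (poly_seq j) z) (H z)).
assert (T2 := Cmod_minus_triangle (peval (poly_seq j) z) (peval P z) (H z)).
rewrite (Cmod_minus_sym (H z)) in HP.
rewrite (Cmod_minus_sym (peval P z) (peval (poly_seq j) z)) in Hj; lra.
Qed.

Lemma approximates_hypercyclic (F : C -> C) (t : R) :
  (forall j M, approximates F t j M) -> hypercyclic (cis t) F.
Proof.
intros HF H HH Q (K & eps & HK & He & HQ).
destruct (compact_set_bounded K HK) as [M HM].
destruct (approximates_translates F t HF H (INR M) eps HH He) as [n Hn].
exists (Nat.iter n (translate (cis t)) F); split; [now exists n|].
apply HQ; intros z Hz; rewrite iter_translate; now apply Hn, HM.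
Qed.

Lemma approximates_universal (F : C -> C) (t : R) :
  (forall j M, approximates F t j M) -> universal F.
Proof.
intros HF H HH.
destruct (functional_choice (fun i n => forall z, Cmod z <= INR i ->
   Cmod (F (z + INR n * cis t) - H z)%C < / INR (S i))) as [n Hn].
{ intros i; apply approximates_translates; auto.
  apply Rinv_0_lt_compat, lt_0_INR; lia. }
exists (fun i => (INR (n i) * cis t)%C); intros Q (K & eps & HK & He & HQ).
destruct (compact_set_bounded K HK) as [M HM].
destruct (exists_large_nat (/ eps)) as [N HN].
exists (M + N)%nat; intros i Hi; apply HQ; intros z Hz; unfold translate.
eapply Rlt_le_trans; [apply Hn|].
- eapply Rle_trans; [now apply HM|]; apply le_INR; lia.
- rewrite <- (Rinv_inv eps); apply Rinv_le_contravar; [now apply Rinv_0_lt_compat|].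
  eapply Rle_trans; [exact HN|]; apply le_INR; lia.
Qed.

Theorem theoremE (A : nat -> R) (phi : R -> R)
  (A_pos : forall i : nat, 0 < A i)
  (A_ratio : is_lim_seq (fun i : nat => A (S i) / A i) 0)
  (phi_series : forall r : R, 0 <= r -> is_pseries A r (phi r)) :
  exists F : C -> C,
    entire F /\
    universal F /\
    (forall z : C, Cmod (F z) <= phi (Cmod z)) /\
    ~ countable (hypercyclic_directions F).
Proof.
destruct (exists_approximating_function A phi A_pos phi_series) as (F & HF & Hb & Happ).
assert (Hres : forall e : nat -> C, exists t,
  (forall j M, approximates F t j M) /\ forall i, cis t <> e i).
{ intros e.
  destruct (baire_interval (fun i t => cis t <> e i /\
    let (j, M) := Cantor.of_nat i in approximates F t j M) 0 PI PI_RGT_0)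
    as (t & _ & Ht).
  - intros i x y Hx Hxy Hy; destruct (Cantor.of_nat i) as [j M].
    destruct (cis_avoid (e i) x y Hx Hxy Hy) as (x1 & y1 & H1 & H2 & H3 & H4).
    destruct (approximates_open_dense F j M x1 y1) as (x2 & y2 & H5 & H6 & H7 & H8);
      [intros c; apply Happ|easy|].
    exists x2, y2; repeat split; try lra; [apply H4; lra|now apply H8].
  - exists t; split; [|intros i; apply Ht].
    intros j M; destruct (Ht (Cantor.to_nat (j, M))) as [_ H].
    now rewrite Cantor.cancel_of_to in H. }
exists F; split; [easy|]; split; [|split; [easy|]].
- destruct (Hres (fun _ => RtoC 0)) as (t & Ht & _).
  now apply approximates_universal with t.
- intros [e He]; destruct (Hres e) as (t & Ht & Hne).
  destruct (He (cis t)) as [i Hi].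
  + split; [apply Cmod_cis|now apply approximates_hypercyclic].
  + now apply (Hne i).
Qed.
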